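(* Let $H_1,H_2$ be Hopf algebras over $k$ (not necessarily finite dimensional) with bijective antipodes. Let $\mathcal{LR}(H_1,H_2)_{fd}$ be the subcategory of $\mathcal{LR}(H_1,H_2)$ consisting of all finite dimensional objects, with the tensor product, unit, conjugation and braiding restricted from $\mathcal{LR}(H_1,H_2)$. Then $\mathcal{LR}(H_1,H_2)_{fd}$ is a rigid braided $T$-category over $G$.
   Context: $k$ is a fixed field; all vector spaces and tensor products are over $k$, and vector spaces are treated as a strict monoidal category. Comultiplications are written $h\mapsto h_1\otimes h_2$ (Sweedler notation). $\mathrm{Aut}_{Hopf}(H)$ is the group of Hopf algebra automorphisms of $H$; juxtaposition of automorphisms denotes composition of maps. Braided $T$-category over a group $G$ with unit $1$. A crossed $T$-category $\mathcal{C}$ over $G$ consists of: a strict monoidal category $\mathcal{C}$; a family of subcategories $\{\mathcal{C}_a\}_{a\in G}$ such that $\mathcal{C}$ is the disjoint union of this family and $U\otimes V\in\mathcal{C}_{ab}$ for all $a,b\in G$, $U\in\mathcal{C}_a$, $V\in\mathcal{C}_b$; and a group homomorphism $\varphi:G\to \mathrm{Aut}(\mathcal{C})$, $b\mapsto\varphi_b$ (the conjugation), into the group of invertible strict tensor functors from $\mathcal{C}$ to itself, such that $\varphi_b(\mathcal{C}_a)=\mathcal{C}_{bab^{-1}}$ for all $a,b\in G$. For $b\in G$ write ${}^b(\cdot)=\varphi_b$, and for $V\in\mathcal{C}_b$ write ${}^V(\cdot)=\varphi_b$. A braided $T$-category is a crossed $T$-category with a family of isomorphisms $c_{U,V}:U\otimes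 V\to {}^UV\otimes U$, $U,V\in\mathcal{C}$, such that: (i) for $f\in \mathrm{Hom}_{\mathcal{C}_a}(U,U')$ and $g\in \mathrm{Hom}_{\mathcal{C}_b}(V,V')$, $({}^{a}g\otimes f)\circ c_{U,V}=c_{U',V'}\circ(f\otimes g)$; (ii) for all $U,V,W\in\mathcal{C}$, $c_{U\otimes V,W}=(c_{U,{}^VW}\otimes id_V)(id_U\otimes c_{V,W})$ and $c_{U,V\otimes W}=(id_{{}^UV}\otimes c_{U,W})(c_{U,V}\otimes id_W)$; (iii) for all $U,V\in\mathcal{C}$ and $a\in G$, $\varphi_a(c_{U,V})=c_{{}^aU,{}^aV}$. It is rigid if every object $M$ has a left dual $M^*$ (with morphisms $ev:M^*\otimes M\to k$, $coev:k\to M\otimes M^*$ satisfying $(id_M\otimes ev)(coev\otimes id_M)=id_M$, $(ev\otimes id_{M^*})(id_{M^*}\otimes coev)=id_{M^*}$) and a right dual ${}^*M$ (with morphisms $ev':M\otimes {}^*M\to k$, $coev':k\to {}^*M\otimes M$ satisfying the analogous identities $(ev'\otimes id_M)(id_M\otimes coev')=id_M$, $(id_{{}^*M}\otimes ev')(coev'\otimes id_{{}^*M})=id_{{}^*M}$), where $k$ denotes the unit object. Category ${}_{H_1}\mathcal{LR}_{H_2}(\alpha,\beta,\gamma,\delta)$ (for $\alpha,\beta\in \mathrm{Aut}_{Hopf}(H_1)$, $\gamma,\delta\in \mathrm{Aut}_{Hopf}(H_2)$): an object is a vector space $M$ which is an $H_1$-$H_2$-bimodule (left $H_1$-action $h'\otimes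 m\mapsto h'\triangleright m$ and right $H_2$-action $m\otimes h''\mapsto m\triangleleft h''$, commuting) and an $H_1$-$H_2$-bicomodule (left $H_1$-coaction $m\mapsto m_{(-1)}\otimes m_{(0)}\in H_1\otimes M$ and right $H_2$-coaction $m\mapsto m_{[0]}\otimes m_{[1]}\in M\otimes H_2$, commuting), such that for all $h'\in H_1$, $h''\in H_2$, $m\in M$: \begin{align*} &\alpha(h'_1)m_{(-1)}\otimes h'_2\triangleright m_{(0)}=(h'_1\triangleright m)_{(-1)}\beta(h'_2)\otimes (h'_1\triangleright m)_{(0)},\\ &(h'\triangleright m)_{[0]}\otimes(h'\triangleright m)_{[1]}=h'\triangleright m_{[0]}\otimes m_{[1]},\\ &m_{[0]}\triangleleft h''_1\otimes m_{[1]}\delta(h''_2)=(m\triangleleft h''_2)_{[0]}\otimes \gamma(h''_1)(m\triangleleft h''_2)_{[1]},\\ &(m\triangleleft h'')_{(-1)}\otimes(m\triangleleft h'')_{(0)}=m_{(-1)}\otimes m_{(0)}\triangleleft h''. \end{align*} Morphisms are the $H_1$-$H_2$-bilinear and $H_1$-$H_2$-bicolinear maps. The group $G$: as a set $G=\mathrm{Aut}_{Hopf}(H_1)^2\times \mathrm{Aut}_{Hopf}(H_2)^2$, with multiplication $$(\alpha_1,\beta_1,\gamma_1,\delta_1)*(\alpha_2,\beta_2,\gamma_2,\delta_2)=(\alpha_2\alpha_1,\ \alpha_2\beta_1\alpha_2^{-1}\beta_2,\ \gamma_1\gamma_2,\ \delta_2\gamma_2^{-1}\delta_1\gamma_2),$$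 unit $(id,id,id,id)$ and inverse $(\alpha,\beta,\gamma,\delta)^{-1}=(\alpha^{-1},\alpha^{-1}\beta^{-1}\alpha,\gamma^{-1},\gamma\delta^{-1}\gamma^{-1})$. Structure of $\mathcal{LR}(H_1,H_2)$: it is the disjoint union of all ${}_{H_1}\mathcal{LR}_{H_2}(\alpha,\beta,\gamma,\delta)$, $(\alpha,\beta,\gamma,\delta)\in G$ (an object comes with its index in $G$; there are no morphisms between different components). Tensor product: for $M\in {}_{H_1}\mathcal{LR}_{H_2}(\alpha_1,\beta_1,\gamma_1,\delta_1)$ and $N\in {}_{H_1}\mathcal{LR}_{H_2}(\alpha_2,\beta_2,\gamma_2,\delta_2)$, $M\otimes N$ is the object of ${}_{H_1}\mathcal{LR}_{H_2}((\alpha_1,\beta_1,\gamma_1,\delta_1)*(\alpha_2,\beta_2,\gamma_2,\delta_2))$ with structures \begin{align*} &h'\triangleright(m\otimes n)=h'_1\triangleright m\otimes h'_2\triangleright n,\\ &(m\otimes n)_{(-1)}\otimes(m\otimes n)_{(0)}=\alpha_2(m_{(-1)})\,\alpha_2\beta_1\alpha_2^{-1}(n_{(-1)})\otimes m_{(0)}\otimes n_{(0)},\\ &(m\otimes n)\triangleleft h''=m\triangleleft \gamma_2(h''_1)\otimes n\triangleleft\gamma_2^{-1}\delta_1\gamma_2(h''_2),\\ &(m\otimes n)_{[0]}\otimes(m\otimes n)_{[1]}=m_{[0]}\otimes n_{[0]}\otimes m_{[1]}n_{[1]}; \end{align*} the tensor product of morphisms is the tensor product of linear maps. The unit is $k$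 with trivial structures, an object of ${}_{H_1}\mathcal{LR}_{H_2}(id,id,id,id)$. Conjugation: for $(\alpha_1,\beta_1,\gamma_1,\delta_1)\in G$ and $N\in {}_{H_1}\mathcal{LR}_{H_2}(\alpha_2,\beta_2,\gamma_2,\delta_2)$, $\varphi_{(\alpha_1,\beta_1,\gamma_1,\delta_1)}(N)={}^{(\alpha_1,\beta_1,\gamma_1,\delta_1)}N$, which is $N$ as a vector space, regarded as an object of ${}_{H_1}\mathcal{LR}_{H_2}((\alpha_1,\beta_1,\gamma_1,\delta_1)*(\alpha_2,\beta_2,\gamma_2,\delta_2)*(\alpha_1,\beta_1,\gamma_1,\delta_1)^{-1})$ with left action $h'\rightharpoonup n=\beta_1^{-1}\alpha_1(h')\triangleright n$, left coaction $n\mapsto\alpha_1^{-1}\alpha_2\beta_1\alpha_2^{-1}(n_{(-1)})\otimes n_{(0)}$, right action $n\leftharpoonup h''=n\triangleleft \gamma_2^{-1}\delta_1\gamma_2\gamma_1^{-1}(h'')$, and right coaction $n\mapsto n_{[0]}\otimes \gamma_1\delta_1^{-1}(n_{[1]})$; $\varphi$ acts as the identity on morphisms. Braiding: for $M\in {}_{H_1}\mathcal{LR}_{H_2}(\alpha_1,\beta_1,\gamma_1,\delta_1)$ and any object $N$, with ${}^MN={}^{(\alpha_1,\beta_1,\gamma_1,\delta_1)}N$, $$c_{M,N}:M\otimes N\to {}^MN\otimes M,\qquad c_{M,N}(m\otimes n)=\beta_1^{-1}(m_{(-1)})\triangleright n_{[0]}\otimes m_{(0)}\triangleleft \delta_1^{-1}(n_{[1]}).$$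 *)

(* Defs.v *)
From HB Require Import structures.
From mathcomp Require Import all_boot all_order all_algebra.
From mathcomp Require Import boolp.

Set Implicit Arguments.
Unset Strict Implicit.
Unset Printing Implicit Defensive.

Import GRing.Theory.
Local Open Scope ring_scope.

Local Open Scope quotient_scope.

Definition bilin (k : fieldType) (U V W : lmodType k) (f : U -> V -> W) : Prop :=
  (forall v, linear (f^~ v)) /\ (forall u, linear (f u)).

Section Tensor.
Variables (k : fieldType) (V W : lmodType k).

(* A formal sum is a list of pairs; two are identified when every bilinear map
   gives them the same value. *)
Definition tens_eq (s t : seq (V * W)) : bool :=
  `[< forall (U : lmodType k) (f : V -> W -> U), bilin f ->
      \sum_(p <- s) f p.1 p.2 = \sum_(p <- t) f p.1 p.2 >].

Lemma tens_eqP s t :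
  reflect (forall (U : lmodType k) (f : V -> W -> U), bilin f ->
             \sum_(p <- s) f p.1 p.2 = \sum_(p <- t) f p.1 p.2) (tens_eq s t).
Proof. exact: asboolP. Qed.

Lemma tens_eq_refl : reflexive tens_eq.
Proof. by move=> s; apply/tens_eqP. Qed.

Lemma tens_eq_sym : symmetric tens_eq.
Proof. by move=> s t; apply/tens_eqP/tens_eqP => h U f bf; rewrite h. Qed.

Lemma tens_eq_trans : transitive tens_eq.
Proof.
by move=> s t u /tens_eqP h1 /tens_eqP h2; apply/tens_eqP => U f bf; rewrite h1 ?h2.
Qed.

Canonical tens_equiv := EquivRel tens_eq tens_eq_refl tens_eq_sym tens_eq_trans.

Definition tens := {eq_quot tens_eq}.
HB.instance Definition _ := Choice.on tens.
HB.instance Definition _ := EqQuotient.on tens.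

(* For bilinear [f] the sum does not depend on the chosen representative of [t]
   (lemma [sweedler_pi]), so it is what Sweedler's notation f(t_1, t_2) denotes;
   [f] must always be bilinear for the expression to be meaningful. *)
Definition sweedler (U : nmodType) (t : tens) (f : V -> W -> U) : U :=
  \sum_(p <- repr t) f p.1 p.2.

Definition pure (v : V) (w : W) : tens := \pi_tens [:: (v, w)].

Lemma sweedler_pi (U : lmodType k) (f : V -> W -> U) s :
  bilin f -> sweedler (\pi_tens s) f = \sum_(p <- s) f p.1 p.2.
Proof.
move=> bf; have /eqmodP/tens_eqP h : (repr (\pi_tens s) = s %[mod tens]) by rewrite reprK.
exact: h.
Qed.

Lemma sweedler_pure (U : lmodType k) (f : V -> W -> U) v w :
  bilin f -> sweedler (pure v w) f = f v w.
Proof. by move=> bf; rewrite sweedler_pi ?big_seq1. Qed.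

Definition tens_zero : tens := \pi_tens [::].
Definition tens_add (t u : tens) : tens := \pi_tens (repr t ++ repr u).
Definition tens_scale (a : k) (t : tens) : tens :=
  \pi_tens [seq (a *: p.1, p.2) | p <- repr t].
Definition tens_opp := tens_scale (-1).

Lemma tens_ext (t u : tens) :
  (forall (U : lmodType k) (f : V -> W -> U), bilin f -> sweedler t f = sweedler u f) ->
  t = u.
Proof. by move=> h; rewrite -[t]reprK -[u]reprK; apply/eqmodP/tens_eqP. Qed.

Lemma sweedler0 (U : lmodType k) (f : V -> W -> U) :
  bilin f -> sweedler tens_zero f = 0.
Proof. by move=> bf; rewrite sweedler_pi ?big_nil. Qed.

Lemma sweedlerD (U : lmodType k) (f : V -> W -> U) t u :
  bilin f -> sweedler (tens_add t u) f = sweedler t f + sweedler u f.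
Proof. by move=> bf; rewrite sweedler_pi ?big_cat. Qed.

Lemma linear_scale (U X : lmodType k) (f : U -> X) a u :
  linear f -> f (a *: u) = a *: f u.
Proof. by move=> lf; rewrite (scalable_linear lf). Qed.

Lemma sweedlerZ (U : lmodType k) (f : V -> W -> U) a t :
  bilin f -> sweedler (tens_scale a t) f = a *: sweedler t f.
Proof.
move=> bf; rewrite sweedler_pi // big_map scaler_sumr; apply: eq_bigr => -[v w] _ /=.
by case: bf => h _; rewrite (linear_scale _ _ (h w)).
Qed.

Let tE := (sweedler0, sweedlerD, sweedlerZ).

Lemma tens_addA : associative tens_add.
Proof. by move=> x y z; apply: tens_ext => U f bf; rewrite !tE ?addrA. Qed.
Lemma tens_addC : commutative tens_add.
Proof. by move=> x y; apply: tens_ext => U f bf; rewrite !tE // addrC. Qed.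
Lemma tens_add0 : left_id tens_zero tens_add.
Proof. by move=> x; apply: tens_ext => U f bf; rewrite !tE ?add0r. Qed.
Lemma tens_addN : left_inverse tens_zero tens_opp tens_add.
Proof.
by move=> x; apply: tens_ext => U f bf; rewrite !tE // scaleN1r addNr.
Qed.

HB.instance Definition _ :=
  GRing.isZmodule.Build tens tens_addA tens_addC tens_add0 tens_addN.

Lemma tens_scaleA a b t : tens_scale a (tens_scale b t) = tens_scale (a * b) t.
Proof. by apply: tens_ext => U f bf; rewrite !tE ?scalerA. Qed.
Lemma tens_scale1 : left_id 1 tens_scale.
Proof. by move=> t; apply: tens_ext => U f bf; rewrite !tE ?scale1r. Qed.
Lemma tens_scaleDr : right_distributive tens_scale +%R.
Proof. by move=> a t u; apply: tens_ext => U f bf; rewrite !tE ?scalerDr. Qed.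
Lemma tens_scaleDl t : {morph tens_scale^~ t : a b / a + b}.
Proof. by move=> a b; apply: tens_ext => U f bf; rewrite !tE ?scalerDl. Qed.

HB.instance Definition _ := GRing.Zmodule_isLmodule.Build k tens
  tens_scaleA tens_scale1 tens_scaleDr tens_scaleDl.

Lemma pure_bilin : bilin pure.
Proof.
split=> v a x y; apply: tens_ext => U f bf;
  rewrite sweedlerD // sweedlerZ // !sweedler_pure //; case: bf => h1 h2.
  exact: (h1 v).
exact: h2.
Qed.

End Tensor.

Arguments pure {k V W}.
Arguments sweedler {k V W U}.

Arguments tens {k} (V W)%_type_scope.
Notation "V ⊗ W" := (tens V W) (at level 40, left associativity) : type_scope.
Notation "v ⊗ w" := (pure v w) (at level 40, left associativity) : ring_scope.
Notation "'\sw_' ( a ⊗ b <- t ) E" := (sweedler t (fun a b => E))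
  (at level 41, a name, b name, t at level 39, E at level 41,
   format "\sw_ ( a  ⊗  b  <-  t )  E") : ring_scope.

Section TensorTheory.
Variable k : fieldType.
Implicit Types U V W X : lmodType k.

Lemma sweedler_linear V W U (f : V -> W -> U) :
  bilin f -> linear (fun t : V ⊗ W => \sw_(v ⊗ w <- t) f v w).
Proof.
move=> bf a x y.
by rewrite -[sweedler x _]/(sweedler x f) (sweedlerD _ _ bf) (sweedlerZ _ _ bf).
Qed.

Lemma sweedler_body V W U X (t : V ⊗ W) (F : X -> V -> W -> U) :
  (forall v w, linear (fun x => F x v w)) ->
  linear (fun x => \sw_(v ⊗ w <- t) F x v w).
Proof.
move=> lF a x y; rewrite /sweedler scaler_sumr -big_split /=.
by apply: eq_bigr => p _; apply: lF.
Qed.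

Lemma eq_sweedler V W (U : nmodType) (t : V ⊗ W) (f g : V -> W -> U) :
  (forall v w, f v w = g v w) -> sweedler t f = sweedler t g.
Proof. by move=> fg; apply: eq_bigr => p _. Qed.

Lemma exchange_sweedler V W V' W' (U : nmodType) (t : V ⊗ W) (t' : V' ⊗ W') f :
  \sw_(v ⊗ w <- t) \sw_(v' ⊗ w' <- t') f v w v' w' =
  \sw_(v' ⊗ w' <- t') \sw_(v ⊗ w <- t) f v w v' w' :> U.
Proof. exact: exchange_big. Qed.

Lemma linear_sweedler V W U X (t : V ⊗ W) (f : V -> W -> U) (L : U -> X) :
  linear L -> L (\sw_(v ⊗ w <- t) f v w) = \sw_(v ⊗ w <- t) L (f v w).
Proof.
move=> lL; rewrite /sweedler; elim: (repr t) => [|p s IH].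
  by rewrite !big_nil; have /= := linear_scale 0 0 lL; rewrite !scale0r.
rewrite !big_cons -IH -[f _ _ in LHS]scale1r.
by rewrite lL scale1r.
Qed.

Lemma comp_linear U V W (f : V -> W) (g : U -> V) :
  linear f -> linear g -> linear (fun x => f (g x)).
Proof. by move=> lf lg a x y; rewrite lg lf. Qed.

Lemma linear_id U : linear (fun x : U => x).
Proof. by []. Qed.

Lemma pure_linl V W (w : W) : linear (fun v : V => v ⊗ w).
Proof. by case: (pure_bilin V W). Qed.
Lemma pure_linr V W (v : V) : linear (fun w : W => v ⊗ w).
Proof. by case: (pure_bilin V W). Qed.

Lemma scale_linr V (a : k) : linear (fun v : V => a *: v).
Proof. by move=> b x y; rewrite scalerDr !scalerA mulrC. Qed.
Lemma scale_linl U V (f : {scalar U}) (v : V) : linear (fun u : U => f u *: v).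
Proof. by move=> b x y; rewrite linearP scalerDl !scalerA. Qed.

Lemma regular_linl V (v : V) : linear (fun a : k^o => (a : k) *: v).
Proof. by move=> b x y; rewrite scalerDl !scalerA. Qed.

Lemma mul_linl (A : algType k) (b : A) : linear (fun a : A => a * b).
Proof. by move=> c x y; rewrite mulrDl scalerAl. Qed.
Lemma mul_linr (A : algType k) (b : A) : linear (fun a : A => b * a).
Proof. by move=> c x y; rewrite mulrDr scalerAr. Qed.

Lemma bundled_linear U V (f : {linear U -> V}) : linear (fun x => f x).
Proof. exact: linearP. Qed.

End TensorTheory.

(* [lin] proves linearity and bilinearity goals, [sw_nf] evaluates nested Sweedler
   sums; [lin_extra] and [sw_rule] are their extension points. *)
Ltac lin_extra := fail.
Ltac lin_head :=
  cbn beta;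
  lazymatch goal with
  | |- linear (@GRing.Linear.sort _ _ _ _ ?f) => exact (bundled_linear f)
  | |- linear (fun x => @GRing.Linear.sort _ _ _ _ ?f x) => exact (bundled_linear f)
  | |- linear (pure _) => apply: pure_linr
  | |- linear (fun x => pure _ x) => apply: pure_linr
  | |- linear (fun x => pure x _) => apply: pure_linl
  | |- linear (GRing.mul _) => exact: mul_linr
  | |- linear (fun x => GRing.mul _ x) => exact: mul_linr
  | |- linear (fun x => GRing.mul x _) => exact: mul_linl
  | |- linear (GRing.scale _) => exact: scale_linr
  | |- linear (fun x => GRing.scale _ x) => exact: scale_linr
  | |- linear (fun x => @GRing.Linear.sort _ _ _ _ ?f x *: ?v) => exact: scale_linl
  | _ => first [ lin_extra | solve [auto 1 with nocore] ]
  end.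
Ltac lin :=
  cbn beta;
  lazymatch goal with
  | |- bilin ?f => first [ assumption | split; (let x := fresh in intro x; lin) ]
  | |- forall _, bilin _ => (let x := fresh in intro x; lin)
  | |- forall _, linear _ => (let x := fresh in intro x; lin)
  | |- forall _ _, linear _ =>
       (let x := fresh in intro x; let y := fresh in intro y; lin)
  | |- linear (fun x => x) => apply: linear_id
  | |- linear (fun x => sweedler (@?t x) (@?F x)) =>
       lazymatch t with
       | (fun x => x) => apply: sweedler_linear; lin
       | (fun _ => ?c) => apply: sweedler_body; lin
       | _ => lazymatch F with
              | (fun _ => ?F0) =>
                apply: (@comp_linear _ _ _ _ (fun y => sweedler y F0) t);
                  [ apply: sweedler_linear; lin | lin ]
              end
       end
  | |- linear (fun x => GRing.scale (@?a x) (@?v x)) =>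
       lazymatch a with
       | (fun _ => ?a0) => apply: (@comp_linear _ _ _ _ (GRing.scale a0) v); [lin_head | lin]
       | (fun x => @GRing.Linear.sort _ _ _ _ ?f (@?g x)) =>
         lazymatch v with
         | (fun _ => ?v0) =>
           apply: (@comp_linear _ _ _ _ (fun y => GRing.scale (f y) v0) g);
             [exact: scale_linl | lin]
         end
       | (fun x => x) => exact: regular_linl
       | _ =>
         lazymatch v with
         | (fun _ => ?v0) => apply: (comp_linear (regular_linl v0)); lin
         end
       end
  | |- linear (fun x => ?f (@?g x)) =>
       lazymatch g with
       | (fun x => x) => lin_head
       | (fun _ => ?v) =>
         match goal with
         | |- linear (fun x => ?f x v) => lin_head
         | |- linear (fun x => ?f (@?g' x) v) =>
           lazymatch g' with
           | (fun _ => ?c) => lin_head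
           | _ => apply: (@comp_linear _ _ _ _ (fun y => f y v) g'); [lin_head | lin]
           end
         | _ => lin_head
         end
       | _ => apply: (@comp_linear _ _ _ _ f g); [lin_head | lin]
       end
  | |- linear ?f => lin_head
  end.

Section TensorTheory2.
Variable k : fieldType.
Implicit Types U V W X : lmodType k.

Lemma pure_spans V W (t : V ⊗ W) : t = \sw_(v ⊗ w <- t) (v ⊗ w).
Proof.
apply: tens_ext => U f bf.
have bf' := bf; rewrite (linear_sweedler t _ (sweedler_linear bf)).
by apply: eq_sweedler => v w; rewrite sweedler_pure.
Qed.

Lemma pure_spansZ V W (a : k) (t : V ⊗ W) : a *: t = \sw_(v ⊗ w <- t) (a *: (v ⊗ w)).
Proof. by rewrite [t in LHS]pure_spans (linear_sweedler _ _ (@scale_linr _ _ a)). Qed.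

Lemma tens_lin_ext V W U (f g : V ⊗ W -> U) :
  linear f -> linear g -> (forall v w, f (v ⊗ w) = g (v ⊗ w)) -> f =1 g.
Proof.
move=> lf lg fg t; rewrite (pure_spans t) (linear_sweedler _ _ lf) (linear_sweedler _ _ lg).
exact: eq_sweedler.
Qed.

Lemma tens_universal V W U (f : V -> W -> U) : bilin f ->
  exists! g : V ⊗ W -> U, linear g /\ forall v w, g (v ⊗ w) = f v w.
Proof.
move=> bf; exists (fun t => sweedler t f); split.
  by split=> [|v w]; [exact: sweedler_linear | rewrite sweedler_pure].
move=> g [lg gE]; apply/funext; apply: tens_lin_ext => // [|v w]; first exact: sweedler_linear.
by rewrite gE sweedler_pure.
Qed.

Lemma sweedler_bind V W V' W' U (t : V ⊗ W) (F : V -> W -> V' ⊗ W') (f : V' -> W' -> U) :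
  bilin f -> sweedler (sweedler t F) f = \sw_(v ⊗ w <- t) sweedler (F v w) f.
Proof. by move=> bf; rewrite (linear_sweedler _ _ (sweedler_linear bf)). Qed.

End TensorTheory2.

Ltac sw_rule := fail.
Ltac sw_nf :=
  cbn beta;
  lazymatch goal with
  | |- sweedler (sweedler _ _) _ = _ =>
      etransitivity; [apply: sweedler_bind; lin | sw_nf]
  | |- sweedler (pure _ _) _ = _ =>
      etransitivity; [apply: sweedler_pure; lin | sw_nf]
  | |- sweedler _ _ = _ =>
      first
      [ etransitivity; [sw_rule | sw_nf]
      | apply: eq_sweedler; (let x := fresh in intro x); (let x := fresh in intro x); sw_nf ]
  | |- ?L (sweedler ?t ?F) = _ =>
      etransitivity; [apply: (linear_sweedler t F (L := L)); lin | sw_nf]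
  | |- ?L (sweedler ?t ?F) ?v = _ =>
      etransitivity; [apply: (linear_sweedler t F (L := fun y => L y v)); lin | sw_nf]
  | |- _ => reflexivity
  end.
Ltac sw_norm := etransitivity; [sw_nf|]; symmetry; etransitivity; [sw_nf|]; symmetry.

Record hopfAlgebra (k : fieldType) := HopfAlgebra {
  hopf_alg :> algType k;
  comul : {linear hopf_alg -> (hopf_alg ⊗ hopf_alg)%type};
  counit : {scalar hopf_alg};
  antipode : {linear hopf_alg -> hopf_alg};
  comulA : forall h : hopf_alg,
    \sw_(a ⊗ b <- comul h) \sw_(a1 ⊗ a2 <- comul a) (a1 ⊗ (a2 ⊗ b)) =
    \sw_(a ⊗ b <- comul h) \sw_(b1 ⊗ b2 <- comul b) (a ⊗ (b1 ⊗ b2));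
  counitl : forall h : hopf_alg, \sw_(a ⊗ b <- comul h) counit a *: b = h;
  counitr : forall h : hopf_alg, \sw_(a ⊗ b <- comul h) counit b *: a = h;
  comul1 : comul 1 = 1 ⊗ 1;
  comulM : forall g h : hopf_alg, comul (g * h) =
    \sw_(a ⊗ b <- comul g) \sw_(c ⊗ d <- comul h) ((a * c) ⊗ (b * d));
  counit1 : counit 1 = 1;
  counitM : forall g h : hopf_alg, counit (g * h) = counit g * counit h;
  antipodel : forall h : hopf_alg,
    \sw_(a ⊗ b <- comul h) (antipode a * b) = (counit h)%:A;
  antipoder : forall h : hopf_alg,
    \sw_(a ⊗ b <- comul h) (a * antipode b) = (counit h)%:A
}.

Arguments comul {k _}.
Arguments counit {k _}.
Arguments antipode {k _}.

Section HopfTheory.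
Variables (k : fieldType) (H : hopfAlgebra k).

Lemma counitl_sw (U : lmodType k) (f : H -> U) (h : H) : linear f ->
  \sw_(a ⊗ b <- comul h) counit a *: f b = f h.
Proof.
move=> lf; rewrite -[in RHS](counitl h) (linear_sweedler _ _ lf).
by apply: eq_sweedler => a b; rewrite (linear_scale _ _ lf).
Qed.

Lemma comulA_sw (U : lmodType k) (f : H -> H -> H -> U) (h : H) :
  (forall a b, linear (fun x => f x a b)) -> (forall a b, linear (fun x => f a x b)) ->
  (forall a b, linear (fun x => f a b x)) ->
  \sw_(a ⊗ b <- comul h) \sw_(a1 ⊗ a2 <- comul a) f a1 a2 b =
  \sw_(a ⊗ b <- comul h) \sw_(b1 ⊗ b2 <- comul b) f a b1 b2.
Proof.
move=> l1 l2 l3.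
have bf a : bilin (f a) by split=> b; [exact: l2 | exact: l3].
have := congr1 (fun t => \sw_(a ⊗ u <- t) \sw_(b ⊗ c <- u) f a b c) (comulA h).
have bS : bilin (fun (a : H) (u : H ⊗ H) => \sw_(b ⊗ c <- u) f a b c).
  by split=> x; lin.
have lS : linear (fun t : H ⊗ (H ⊗ H) => \sw_(a ⊗ u <- t) \sw_(b ⊗ c <- u) f a b c) by lin.
rewrite !(linear_sweedler _ _ lS) => E.
etransitivity; [|etransitivity; [exact: E|]]; sw_norm; exact: erefl.
Qed.

Lemma comul1_sw (U : lmodType k) (f : H -> H -> U) : bilin f ->
  \sw_(a ⊗ b <- comul 1) f a b = f 1 1.
Proof. by move=> bf; rewrite comul1 sweedler_pure. Qed.

Lemma counitr_sw (U : lmodType k) (f : H -> U) (h : H) : linear f ->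
  \sw_(a ⊗ b <- comul h) counit b *: f a = f h.
Proof.
move=> lf; rewrite -[in RHS](counitr h) (linear_sweedler _ _ lf).
by apply: eq_sweedler => a b; rewrite (linear_scale _ _ lf).
Qed.

Lemma comulM_sw (U : lmodType k) (f : H -> H -> U) (g h : H) : bilin f ->
  \sw_(a ⊗ b <- comul (g * h)) f a b =
  \sw_(a ⊗ b <- comul g) \sw_(c ⊗ d <- comul h) f (a * c) (b * d).
Proof.
move=> bf; rewrite comulM; sw_norm; exact: erefl.
Qed.

End HopfTheory.

Record hopf_morphism (k : fieldType) (H : hopfAlgebra k) (f : H -> H) : Prop := {
  hmor_linear : linear f;
  hmor1 : f 1 = 1;
  hmorM : {morph f : x y / x * y};
  hmor_comul : forall h, comul (f h) = \sw_(a ⊗ b <- comul h) (f a ⊗ f b);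
  hmor_counit : forall h, counit (f h) = counit h;
  hmor_antipode : forall h, antipode (f h) = f (antipode h)
}.

(* The inverse is determined by the map; it is recorded for convenience. *)
Record hopfAut (k : fieldType) (H : hopfAlgebra k) := HopfAut {
  haut :> H -> H;
  haut_inv : H -> H;
  hautK : cancel haut haut_inv;
  hautVK : cancel haut_inv haut;
  haut_morphism : hopf_morphism haut
}.

Section AutGroup.
Variables (k : fieldType) (H : hopfAlgebra k).
Local Notation Aut := (hopfAut H).

HB.instance Definition _ := gen_eqMixin Aut.
HB.instance Definition _ := gen_choiceMixin Aut.

Lemma hautP (f g : Aut) : f =1 g -> f = g.
Proof.
case: f g => f fi fK fiK fm [g gi gK giK gm] /= /funext fg.
rewrite -{}fg in gK giK gm *.
have fgi : fi = gi by apply/funext => x; rewrite -{1}[x]giK fK.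
by rewrite -{}fgi in gK giK *; congr HopfAut; exact: Prop_irrelevance.
Qed.

Lemma id_hopf_morphism : hopf_morphism (@id H).
Proof. by split=> //= h; exact: pure_spans. Qed.
Definition haut_one : Aut :=
  @HopfAut k H id id (fun=> erefl) (fun=> erefl) id_hopf_morphism.

Lemma haut_lin (f : Aut) : linear f. Proof. exact: hmor_linear (haut_morphism f). Qed.
Lemma haut1 (f : Aut) : f 1 = 1. Proof. exact: hmor1 (haut_morphism f). Qed.
Lemma hautM (f : Aut) : {morph f : x y / x * y}.
Proof. exact: hmorM (haut_morphism f). Qed.
Lemma haut_comul (f : Aut) h : comul (f h) = \sw_(a ⊗ b <- comul h) (f a ⊗ f b).
Proof. exact: hmor_comul (haut_morphism f) h. Qed.
Lemma haut_counit (f : Aut) h : counit (f h) = counit h.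
Proof. exact: hmor_counit (haut_morphism f) h. Qed.
Lemma haut_antipode (f : Aut) h : antipode (f h) = f (antipode h).
Proof. exact: hmor_antipode (haut_morphism f) h. Qed.

Ltac lin_extra ::= exact: haut_lin.

Lemma comul_haut_sw (U : lmodType k) (f : Aut) (F : H -> H -> U) (h : H) : bilin F ->
  \sw_(a ⊗ b <- comul (f h)) F a b = \sw_(a ⊗ b <- comul h) F (f a) (f b).
Proof. move=> bF; rewrite haut_comul; sw_norm; exact: erefl. Qed.

Lemma comp_hopf_morphism (f g : Aut) : hopf_morphism (fun h => f (g h)).
Proof.
split=> [|||h|h|h]; first by lin.
- by rewrite !haut1.
- by move=> x y; rewrite !hautM.
- by rewrite haut_comul comul_haut_sw //; lin.
- by rewrite !haut_counit.
- by rewrite !haut_antipode.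
Qed.

Definition haut_mul (f g : Aut) : Aut :=
  @HopfAut k H (fun h => f (g h)) (fun h => haut_inv g (haut_inv f h))
    (can_comp (hautK f) (hautK g)) (can_comp (hautVK g) (hautVK f))
    (comp_hopf_morphism f g).

Lemma inv_hopf_morphism (f : Aut) : hopf_morphism (haut_inv f).
Proof.
have fI := can_inj (hautK f).
have lg : linear (haut_inv f).
  by move=> a x y; apply: fI; rewrite haut_lin !hautVK.
split=> // [|x y|h|h|h].
- by apply: fI; rewrite hautVK haut1.
- by apply: fI; rewrite hautM !hautVK.
- rewrite -{2}[h](hautVK f) comul_haut_sw; last by lin.
  rewrite [LHS]pure_spans; apply: eq_sweedler => a b.
  by rewrite !hautK.
- by rewrite -{2}[h](hautVK f) haut_counit.
- by apply: fI; rewrite hautVK -haut_antipode hautVK.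
Qed.

Definition haut_V (f : Aut) : Aut :=
  @HopfAut k H (haut_inv f) f (hautVK f) (hautK f) (inv_hopf_morphism f).

Lemma haut_mulA : associative haut_mul. Proof. by move=> f g h; exact: hautP. Qed.
Lemma haut_mul1g : left_id haut_one haut_mul. Proof. by move=> f; exact: hautP. Qed.
Lemma haut_mulg1 : right_id haut_one haut_mul. Proof. by move=> f; exact: hautP. Qed.
Lemma haut_mulVg : left_inverse haut_one haut_V haut_mul.
Proof. by move=> f; apply: hautP => h /=; rewrite hautK. Qed.
Lemma haut_mulgV : right_inverse haut_one haut_V haut_mul.
Proof. by move=> f; apply: hautP => h /=; rewrite hautVK. Qed.

HB.instance Definition _ := isGroup.Build Aut
  haut_mulA haut_mul1g haut_mulg1 haut_mulVg haut_mulgV.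

Lemma hautMul (f g : Aut) h : (f * g)%g h = f (g h). Proof. by []. Qed.
Lemma haut1E h : (1%g : Aut) h = h. Proof. by []. Qed.
Lemma hautKV (f : Aut) : cancel f (f^-1)%g. Proof. exact: hautK. Qed.
Lemma hautVKV (f : Aut) : cancel (f^-1)%g f. Proof. exact: hautVK. Qed.

End AutGroup.

Section IndexGroup.
Variables (k : fieldType) (H1 H2 : hopfAlgebra k).

Record lr_index := LRIndex {
  ix_alpha : hopfAut H1; ix_beta : hopfAut H1;
  ix_gamma : hopfAut H2; ix_delta : hopfAut H2
}.

HB.instance Definition _ := gen_eqMixin lr_index.
HB.instance Definition _ := gen_choiceMixin lr_index.

Local Open Scope group_scope.
Local Notation α := ix_alpha.
Local Notation β := ix_beta.
Local Notation γ := ix_gamma.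
Local Notation δ := ix_delta.

Definition ix_one := LRIndex 1 1 1 1.
Definition ix_mul (g1 g2 : lr_index) : lr_index :=
  LRIndex (α g2 * α g1) (α g2 * β g1 * (α g2)^-1 * β g2)
          (γ g1 * γ g2) (δ g2 * (γ g2)^-1 * δ g1 * γ g2).
Definition ix_inv (g : lr_index) : lr_index :=
  LRIndex (α g)^-1 ((α g)^-1 * (β g)^-1 * α g) (γ g)^-1 (γ g * (δ g)^-1 * (γ g)^-1).

Lemma ix_mulA : associative ix_mul.
Proof.
move=> [a1 b1 c1 d1] [a2 b2 c2 d2] [a3 b3 c3 d3]; rewrite /ix_mul /=.
by rewrite !invgM !mulgA !mulgVK !mulgK.
Qed.
Lemma ix_mul1 : left_id ix_one ix_mul.
Proof. by move=> [a b c d]; rewrite /ix_mul /=; rewrite !(mulg1, mul1g) mulgV mul1g mulgVK. Qed.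
Lemma ix_mulr1 : right_id ix_one ix_mul.
Proof. by move=> [a b c d]; rewrite /ix_mul /=; rewrite ?invg1 !(mulg1, mul1g). Qed.
Lemma ix_mulV : left_inverse ix_one ix_inv ix_mul.
Proof.
move=> [a b c d]; rewrite /ix_mul /=; congr LRIndex;
  by rewrite ?invgK ?mulgA !(mulgK, mulgVK, mulgV, mulVg, mul1g, mulg1).
Qed.
Lemma ix_mulrV : right_inverse ix_one ix_inv ix_mul.
Proof.
move=> [a b c d]; rewrite /ix_mul /=; congr LRIndex;
  by rewrite ?invgK ?mulgA !(mulgK, mulgVK, mulgV, mulVg, mul1g, mulg1).
Qed.

HB.instance Definition _ := isGroup.Build lr_index
  ix_mulA ix_mul1 ix_mulr1 ix_mulV ix_mulrV.

End IndexGroup.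

Section LRModules.
Variables (k : fieldType) (H1 H2 : hopfAlgebra k).
Local Notation G := (lr_index H1 H2).

Record lr_axioms (g : G) (M : lmodType k)
    (lact : H1 -> M -> M) (ract : M -> H2 -> M)
    (lcoact : M -> H1 ⊗ M) (rcoact : M -> M ⊗ H2) : Prop := {
  lr_lact_bilin : bilin lact;
  lr_lact1 : forall m, lact 1 m = m;
  lr_lactM : forall g h m, lact (g * h) m = lact g (lact h m);
  lr_ract_bilin : bilin ract;
  lr_ract1 : forall m, ract m 1 = m;
  lr_ractM : forall g h m, ract m (g * h) = ract (ract m g) h;
  lr_bimod : forall h h' m, ract (lact h m) h' = lact h (ract m h');
  lr_lcoact_linear : linear lcoact;
  lr_lcoactA : forall m,
    \sw_(x ⊗ m0 <- lcoact m) \sw_(x1 ⊗ x2 <- comul x) (x1 ⊗ (x2 ⊗ m0)) =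
    \sw_(x ⊗ m0 <- lcoact m) \sw_(y ⊗ m00 <- lcoact m0) (x ⊗ (y ⊗ m00));
  lr_lcoact_counit : forall m, \sw_(x ⊗ m0 <- lcoact m) counit x *: m0 = m;
  lr_rcoact_linear : linear rcoact;
  lr_rcoactA : forall m,
    \sw_(m0 ⊗ x <- rcoact m) \sw_(m00 ⊗ y <- rcoact m0) (m00 ⊗ (y ⊗ x)) =
    \sw_(m0 ⊗ x <- rcoact m) \sw_(x1 ⊗ x2 <- comul x) (m0 ⊗ (x1 ⊗ x2));
  lr_rcoact_counit : forall m, \sw_(m0 ⊗ x <- rcoact m) counit x *: m0 = m;
  lr_bicomod : forall m,
    \sw_(x ⊗ m0 <- lcoact m) \sw_(m00 ⊗ y <- rcoact m0) (x ⊗ (m00 ⊗ y)) =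
    \sw_(m0 ⊗ y <- rcoact m) \sw_(x ⊗ m00 <- lcoact m0) (x ⊗ (m00 ⊗ y));
  lr_lact_lcoact : forall h m,
    \sw_(h1 ⊗ h2 <- comul h) \sw_(x ⊗ m0 <- lcoact m)
      ((ix_alpha g h1 * x) ⊗ lact h2 m0) =
    \sw_(h1 ⊗ h2 <- comul h) \sw_(x ⊗ m0 <- lcoact (lact h1 m))
      ((x * ix_beta g h2) ⊗ m0);
  lr_lact_rcoact : forall h m,
    rcoact (lact h m) = \sw_(m0 ⊗ y <- rcoact m) (lact h m0 ⊗ y);
  lr_ract_rcoact : forall h m,
    \sw_(h1 ⊗ h2 <- comul h) \sw_(m0 ⊗ y <- rcoact m)
      (ract m0 h1 ⊗ (y * ix_delta g h2)) =
    \sw_(h1 ⊗ h2 <- comul h) \sw_(m0 ⊗ y <- rcoact (ract m h2))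
      (m0 ⊗ (ix_gamma g h1 * y));
  lr_ract_lcoact : forall h m,
    lcoact (ract m h) = \sw_(x ⊗ m0 <- lcoact m) (x ⊗ ract m0 h)
}.

Record lrModule := LRModule {
  lr_space :> lmodType k;
  lr_deg : G;
  lact : H1 -> lr_space -> lr_space;
  ract : lr_space -> H2 -> lr_space;
  lcoact : lr_space -> H1 ⊗ lr_space;
  rcoact : lr_space -> lr_space ⊗ H2;
  lr_laws : lr_axioms lr_deg lact ract lcoact rcoact
}.

Section Theory.
Variables (M : lrModule) (U : lmodType k).
Implicit Types (m : M).

Lemma lact_linl m : linear (fun h => lact h m).
Proof. by case: (lr_lact_bilin (lr_laws M)). Qed.
Lemma lact_linr h : linear (fun m : M => lact h m).
Proof. by case: (lr_lact_bilin (lr_laws M)). Qed.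
Lemma ract_linl h : linear (fun m : M => ract m h).
Proof. by case: (lr_ract_bilin (lr_laws M)). Qed.
Lemma ract_linr m : linear (fun h => ract m h).
Proof. by case: (lr_ract_bilin (lr_laws M)). Qed.
Lemma lcoact_lin : linear (fun m : M => lcoact m).
Proof. exact: lr_lcoact_linear (lr_laws M). Qed.
Lemma rcoact_lin : linear (fun m : M => rcoact m).
Proof. exact: lr_rcoact_linear (lr_laws M). Qed.

End Theory.

End LRModules.

Ltac lin_extra ::=
  lazymatch goal with
  | |- linear (haut _) => apply: haut_lin
  | |- linear (fun x => haut _ x) => apply: haut_lin
  | |- linear (fun x => lact x _) => apply: lact_linl
  | |- linear (lact _) => apply: lact_linr
  | |- linear (fun x => lact _ x) => apply: lact_linr
  | |- linear (fun x => ract _ x) => apply: ract_linr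
  | |- linear (fun x => ract x _) => apply: ract_linl
  | |- linear (ract _) => apply: ract_linr
  | |- linear (@lcoact _ _ _ _) => apply: lcoact_lin
  | |- linear (@rcoact _ _ _ _) => apply: rcoact_lin
  | |- linear (fun x => lcoact x) => apply: lcoact_lin
  | |- linear (fun x => rcoact x) => apply: rcoact_lin
  end.

Section LRTheory.
Variables (k : fieldType) (H1 H2 : hopfAlgebra k).
Local Notation lrModule := (lrModule H1 H2).

Section Theory2.
Variables (M : lrModule) (U : lmodType k).
Implicit Types (m : M).

Lemma lcoactA_sw (f : H1 -> H1 -> M -> U) m :
  (forall a b, linear (fun x => f x a b)) -> (forall a b, linear (fun x => f a x b)) ->
  (forall a b, linear (fun x => f a b x)) ->
  \sw_(x ⊗ m0 <- lcoact m) \sw_(x1 ⊗ x2 <- comul x) f x1 x2 m0 =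
  \sw_(x ⊗ m0 <- lcoact m) \sw_(y ⊗ m00 <- lcoact m0) f x y m00.
Proof.
move=> l1 l2 l3.
have := congr1 (fun t => \sw_(a ⊗ u <- t) \sw_(b ⊗ c <- u) f a b c) (lr_lcoactA (lr_laws M) m).
cbn beta => E; etransitivity; [|etransitivity; [exact: E|]]; sw_norm; exact: erefl.
Qed.

Lemma rcoactA_sw (f : M -> H2 -> H2 -> U) m :
  (forall a b, linear (fun x => f x a b)) -> (forall a b, linear (fun x => f a x b)) ->
  (forall a b, linear (fun x => f a b x)) ->
  \sw_(m0 ⊗ x <- rcoact m) \sw_(m00 ⊗ y <- rcoact m0) f m00 y x =
  \sw_(m0 ⊗ x <- rcoact m) \sw_(x1 ⊗ x2 <- comul x) f m0 x1 x2.
Proof.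
move=> l1 l2 l3.
have := congr1 (fun t => \sw_(a ⊗ u <- t) \sw_(b ⊗ c <- u) f a b c) (lr_rcoactA (lr_laws M) m).
cbn beta => E; etransitivity; [|etransitivity; [exact: E|]]; sw_norm; exact: erefl.
Qed.

Lemma lcoact_counit_sw (f : M -> U) m : linear f ->
  \sw_(x ⊗ m0 <- lcoact m) counit x *: f m0 = f m.
Proof.
move=> lf; rewrite -[in RHS](lr_lcoact_counit (lr_laws M) m) (linear_sweedler _ _ lf).
by apply: eq_sweedler => a b; rewrite (linear_scale _ _ lf).
Qed.

Lemma rcoact_counit_sw (f : M -> U) m : linear f ->
  \sw_(m0 ⊗ x <- rcoact m) counit x *: f m0 = f m.
Proof.
move=> lf; rewrite -[in RHS](lr_rcoact_counit (lr_laws M) m) (linear_sweedler _ _ lf).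
by apply: eq_sweedler => a b; rewrite (linear_scale _ _ lf).
Qed.

Lemma bicomod_sw (f : H1 -> M -> H2 -> U) m :
  (forall a b, linear (fun x => f x a b)) -> (forall a b, linear (fun x => f a x b)) ->
  (forall a b, linear (fun x => f a b x)) ->
  \sw_(x ⊗ m0 <- lcoact m) \sw_(m00 ⊗ y <- rcoact m0) f x m00 y =
  \sw_(m0 ⊗ y <- rcoact m) \sw_(x ⊗ m00 <- lcoact m0) f x m00 y.
Proof.
move=> l1 l2 l3.
have := congr1 (fun t => \sw_(a ⊗ u <- t) \sw_(b ⊗ c <- u) f a b c) (lr_bicomod (lr_laws M) m).
cbn beta => E; etransitivity; [|etransitivity; [exact: E|]]; sw_norm; exact: erefl.
Qed.

Lemma lact_lcoact_sw (f : H1 -> M -> U) h m : bilin f ->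
  \sw_(h1 ⊗ h2 <- comul h) \sw_(x ⊗ m0 <- lcoact m)
    f (ix_alpha (lr_deg M) h1 * x) (lact h2 m0) =
  \sw_(h1 ⊗ h2 <- comul h) \sw_(x ⊗ m0 <- lcoact (lact h1 m))
    f (x * ix_beta (lr_deg M) h2) m0.
Proof.
move=> bf; have := congr1 (fun t => sweedler t f) (lr_lact_lcoact (lr_laws M) h m).
cbn beta => E; etransitivity; [|etransitivity; [exact: E|]]; sw_norm; exact: erefl.
Qed.

Lemma ract_rcoact_sw (f : M -> H2 -> U) h m : bilin f ->
  \sw_(h1 ⊗ h2 <- comul h) \sw_(m0 ⊗ y <- rcoact m)
    f (ract m0 h1) (y * ix_delta (lr_deg M) h2) =
  \sw_(h1 ⊗ h2 <- comul h) \sw_(m0 ⊗ y <- rcoact (ract m h2))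
    f m0 (ix_gamma (lr_deg M) h1 * y).
Proof.
move=> bf; have := congr1 (fun t => sweedler t f) (lr_ract_rcoact (lr_laws M) h m).
cbn beta => E; etransitivity; [|etransitivity; [exact: E|]]; sw_norm; exact: erefl.
Qed.

Lemma lact_rcoact_sw (f : M -> H2 -> U) h m : bilin f ->
  \sw_(m0 ⊗ y <- rcoact (lact h m)) f m0 y = \sw_(m0 ⊗ y <- rcoact m) f (lact h m0) y.
Proof. move=> bf; rewrite (lr_lact_rcoact (lr_laws M)); sw_norm; exact: erefl. Qed.

Lemma ract_lcoact_sw (f : H1 -> M -> U) h m : bilin f ->
  \sw_(x ⊗ m0 <- lcoact (ract m h)) f x m0 = \sw_(x ⊗ m0 <- lcoact m) f x (ract m0 h).
Proof. move=> bf; rewrite (lr_ract_lcoact (lr_laws M)); sw_norm; exact: erefl. Qed.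

End Theory2.

End LRTheory.

Ltac sw_rule ::=
  lazymatch goal with
  | |- sweedler (@GRing.Linear.sort _ _ _ _ _ (haut _ _)) _ = _ => apply: comul_haut_sw; lin
  | |- sweedler (@GRing.Linear.sort _ _ _ _ _ (GRing.mul _ _)) _ = _ => apply: comulM_sw; lin
  | |- sweedler (@GRing.Linear.sort _ _ _ _ _ (GRing.one _)) _ = _ => apply: comul1_sw; lin
  | |- sweedler (rcoact (lact _ _)) _ = _ => apply: lact_rcoact_sw; lin
  | |- sweedler (lcoact (ract _ _)) _ = _ => apply: ract_lcoact_sw; lin
  end.

Section LRTensor.
Variables (k : fieldType) (H1 H2 : hopfAlgebra k) (M N : lrModule H1 H2).
Local Notation g1 := (lr_deg M).
Local Notation g2 := (lr_deg N).
Local Notation α := ix_alpha.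
Local Notation β := ix_beta.
Local Notation γ := ix_gamma.
Local Notation δ := ix_delta.

Definition tens_lact (h : H1) (t : M ⊗ N) : M ⊗ N :=
  \sw_(h1 ⊗ h2 <- comul h) \sw_(m ⊗ n <- t) (lact h1 m ⊗ lact h2 n).
Definition tens_lcoact (t : M ⊗ N) : H1 ⊗ (M ⊗ N) :=
  \sw_(m ⊗ n <- t) \sw_(x ⊗ m0 <- lcoact m) \sw_(y ⊗ n0 <- lcoact n)
    ((α g2 x * (α g2 * β g1 * (α g2)^-1)%g y) ⊗ (m0 ⊗ n0)).
Definition tens_ract (t : M ⊗ N) (h : H2) : M ⊗ N :=
  \sw_(h1 ⊗ h2 <- comul h) \sw_(m ⊗ n <- t)
    (ract m (γ g2 h1) ⊗ ract n (((γ g2)^-1 * δ g1 * γ g2)%g h2)).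
Definition tens_rcoact (t : M ⊗ N) : (M ⊗ N) ⊗ H2 :=
  \sw_(m ⊗ n <- t) \sw_(m0 ⊗ x <- rcoact m) \sw_(n0 ⊗ y <- rcoact n)
    ((m0 ⊗ n0) ⊗ (x * y)).

Lemma tens_lact_bilin : bilin tens_lact.
Proof. by split=> [t|h]; rewrite /tens_lact; lin. Qed.
Lemma tens_ract_bilin : bilin tens_ract.
Proof. by split=> [t|h]; rewrite /tens_ract; lin. Qed.
Lemma tens_lcoact_lin : linear tens_lcoact.
Proof. by rewrite /tens_lcoact; lin. Qed.
Lemma tens_rcoact_lin : linear tens_rcoact.
Proof. by rewrite /tens_rcoact; lin. Qed.

Ltac tens_ext m n :=
  let t := fresh in intro t; move: t; apply: tens_lin_ext; [lin | lin | move=> m n].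

Ltac under_sw tac :=
  etransitivity; [apply: eq_sweedler => ? ?; tac | cbn beta].
Ltac step tac := etransitivity; [tac | cbn beta].

Lemma tens_lact1 : forall t, tens_lact 1 t = t.
Proof.
rewrite /tens_lact; tens_ext m n.
by sw_norm; rewrite !(lr_lact1 (lr_laws _)).
Qed.

Lemma tens_lactM g h : forall t, tens_lact (g * h) t = tens_lact g (tens_lact h t).
Proof.
rewrite /tens_lact; tens_ext m n; sw_norm.
by apply: eq_sweedler => a b; apply: eq_sweedler => c d; rewrite !(lr_lactM (lr_laws _)).
Qed.

Lemma tens_ract1 : forall t, tens_ract t 1 = t.
Proof.
rewrite /tens_ract; tens_ext m n.
by sw_norm; rewrite !haut1 !(lr_ract1 (lr_laws _)).
Qed.

Lemma tens_ractM g h : forall t, tens_ract t (g * h) = tens_ract (tens_ract t g) h.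
Proof.
rewrite /tens_ract; tens_ext m n; sw_norm; rewrite [LHS]exchange_sweedler.
do 2![apply: eq_sweedler => ? ?]; by rewrite !hautM !(lr_ractM (lr_laws _)).
Qed.

Lemma tens_bimod h h' : forall t, tens_ract (tens_lact h t) h' = tens_lact h (tens_ract t h').
Proof.
rewrite /tens_ract /tens_lact; tens_ext m n; sw_norm; rewrite [LHS]exchange_sweedler.
do 2![apply: eq_sweedler => ? ?]; by rewrite !(lr_bimod (lr_laws _)).
Qed.

Lemma tens_lcoactA : forall t,
    \sw_(x ⊗ m0 <- tens_lcoact t) \sw_(x1 ⊗ x2 <- comul x) (x1 ⊗ (x2 ⊗ m0)) =
    \sw_(x ⊗ m0 <- tens_lcoact t) \sw_(y ⊗ m00 <- tens_lcoact m0) (x ⊗ (y ⊗ m00)).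
Proof.
rewrite /tens_lcoact; tens_ext m n; sw_norm.
under_sw ltac:(exact: exchange_sweedler).
step ltac:(apply: lcoactA_sw; lin).
apply: eq_sweedler => x m0.
under_sw ltac:(apply: lcoactA_sw; lin).
by rewrite [LHS]exchange_sweedler.
Qed.

Lemma tens_lcoact_counit : forall t, \sw_(x ⊗ m0 <- tens_lcoact t) counit x *: m0 = t.
Proof.
rewrite /tens_lcoact; tens_ext m n; sw_norm.
transitivity (\sw_(x ⊗ m0 <- lcoact m) counit x *: (m0 ⊗ n)); last first.
  by apply: (lcoact_counit_sw (f := fun m0 => m0 ⊗ n)); lin.
apply: eq_sweedler => x m0.
transitivity (\sw_(y ⊗ n0 <- lcoact n) counit y *: (counit x *: (m0 ⊗ n0))).
  apply: eq_sweedler => y n0.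
  by rewrite scalerA counitM !haut_counit mulrC.
by apply: (lcoact_counit_sw (f := fun n0 => counit x *: (m0 ⊗ n0))); lin.
Qed.

Lemma tens_rcoactA : forall t,
    \sw_(m0 ⊗ x <- tens_rcoact t) \sw_(m00 ⊗ y <- tens_rcoact m0) (m00 ⊗ (y ⊗ x)) =
    \sw_(m0 ⊗ x <- tens_rcoact t) \sw_(x1 ⊗ x2 <- comul x) (m0 ⊗ (x1 ⊗ x2)).
Proof.
rewrite /tens_rcoact; tens_ext m n; sw_norm.
under_sw ltac:(exact: exchange_sweedler).
step ltac:(apply: rcoactA_sw; lin).
apply: eq_sweedler => m0 x.
under_sw ltac:(apply: rcoactA_sw; lin).
by rewrite [LHS]exchange_sweedler.
Qed.

Lemma tens_rcoact_counit : forall t, \sw_(m0 ⊗ x <- tens_rcoact t) counit x *: m0 = t.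
Proof.
rewrite /tens_rcoact; tens_ext m n; sw_norm.
transitivity (\sw_(m0 ⊗ x <- rcoact m) counit x *: (m0 ⊗ n)); last first.
  by apply: (rcoact_counit_sw (f := fun m0 => m0 ⊗ n)); lin.
apply: eq_sweedler => m0 x.
transitivity (\sw_(n0 ⊗ y <- rcoact n) counit y *: (counit x *: (m0 ⊗ n0))).
  apply: eq_sweedler => n0 y.
  by rewrite scalerA counitM mulrC.
by apply: (rcoact_counit_sw (f := fun n0 => counit x *: (m0 ⊗ n0))); lin.
Qed.

Lemma tens_bicomod : forall t,
    \sw_(x ⊗ m0 <- tens_lcoact t) \sw_(m00 ⊗ y <- tens_rcoact m0) (x ⊗ (m00 ⊗ y)) =
    \sw_(m0 ⊗ y <- tens_rcoact t) \sw_(x ⊗ m00 <- tens_lcoact m0) (x ⊗ (m00 ⊗ y)).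
Proof.
rewrite /tens_rcoact /tens_lcoact; tens_ext m n; sw_norm.
under_sw ltac:(exact: exchange_sweedler).
step ltac:(apply: bicomod_sw; lin).
apply: eq_sweedler => m0 x.
under_sw ltac:(apply: bicomod_sw; lin).
by rewrite [LHS]exchange_sweedler.
Qed.

Lemma tens_lact_lcoact h : forall t,
    \sw_(h1 ⊗ h2 <- comul h) \sw_(x ⊗ m0 <- tens_lcoact t)
      ((α (g1 * g2)%g h1 * x) ⊗ tens_lact h2 m0) =
    \sw_(h1 ⊗ h2 <- comul h) \sw_(x ⊗ m0 <- tens_lcoact (tens_lact h1 t))
      ((x * β (g1 * g2)%g h2) ⊗ m0).
Proof.
rewrite /tens_lact /tens_lcoact; tens_ext m n; sw_norm.
set f := α g2; set g := (α g2 * β g1 * (α g2)^-1)%g.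
have gf a : g (f a) = f (β g1 a) by rewrite /g /f /= hautK.
transitivity (\sw_(h1 ⊗ h2 <- comul h) \sw_(h11 ⊗ h12 <- comul h1)
    \sw_(x ⊗ m0 <- lcoact m) \sw_(y ⊗ n0 <- lcoact n)
    ((f (α g1 h11 * x) * g y) ⊗ (lact h12 m0 ⊗ lact h2 n0))).
  symmetry; step ltac:(apply: comulA_sw; lin).
  apply: eq_sweedler => h1 h2; rewrite [LHS]exchange_sweedler.
apply: eq_sweedler => x m0; rewrite [LHS]exchange_sweedler.
  by do 2![apply: eq_sweedler => ? ?]; rewrite hautM !mulrA.
transitivity (\sw_(h1 ⊗ h2 <- comul h) \sw_(h11 ⊗ h12 <- comul h1)
    \sw_(x ⊗ m0 <- lcoact (lact h11 m)) \sw_(y ⊗ n0 <- lcoact n)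
    ((f (x * β g1 h12) * g y) ⊗ (m0 ⊗ lact h2 n0))).
  apply: eq_sweedler => h1 h2.
  apply: (lact_lcoact_sw h1 m (f := fun x m0 =>
    \sw_(y ⊗ n0 <- lcoact n) ((f x * g y) ⊗ (m0 ⊗ lact h2 n0)))); lin.
step ltac:(apply: comulA_sw; lin).
symmetry; step ltac:(apply: comulA_sw; lin); symmetry.
apply: eq_sweedler => h1 h2; rewrite [LHS]exchange_sweedler [RHS]exchange_sweedler.
apply: eq_sweedler => x m0.
have := lact_lcoact_sw h2 n (f := fun y n0 => (f x * g y) ⊗ (m0 ⊗ n0)).
move=> E; etransitivity; [etransitivity; [|apply: E; lin]|];
  do 2![apply: eq_sweedler => ? ?]; cbn beta.
  by rewrite hautM hautM gf !mulrA.
by rewrite hautM !mulrA.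
Qed.

Lemma tens_lact_rcoact h : forall t,
    tens_rcoact (tens_lact h t) = \sw_(m0 ⊗ y <- tens_rcoact t) (tens_lact h m0 ⊗ y).
Proof.
rewrite /tens_lact /tens_rcoact; tens_ext m n; sw_norm.
rewrite [LHS]exchange_sweedler; apply: eq_sweedler => m0 x.
by rewrite [LHS]exchange_sweedler.
Qed.

Lemma tens_ract_rcoact h : forall t,
    \sw_(h1 ⊗ h2 <- comul h) \sw_(m0 ⊗ y <- tens_rcoact t)
      (tens_ract m0 h1 ⊗ (y * δ (g1 * g2)%g h2)) =
    \sw_(h1 ⊗ h2 <- comul h) \sw_(m0 ⊗ y <- tens_rcoact (tens_ract t h2))
      (m0 ⊗ (γ (g1 * g2)%g h1 * y)).
Proof.
rewrite /tens_ract /tens_rcoact; tens_ext m n; sw_norm.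
set q := ((γ g2)^-1 * δ g1 * γ g2)%g.
have qE a : γ g2 (q a) = δ g1 (γ g2 a) by rewrite /q /= hautVK.
transitivity (\sw_(h1 ⊗ h2 <- comul h) \sw_(h21 ⊗ h22 <- comul h2)
    \sw_(m0 ⊗ x <- rcoact m) \sw_(n0 ⊗ y <- rcoact n)
    ((ract m0 (γ g2 h1) ⊗ ract n0 (q h21)) ⊗ (x * (y * δ g2 (q h22))))).
  symmetry; step ltac:(symmetry; apply: comulA_sw; lin).
  apply: eq_sweedler => h1 h2; rewrite [LHS]exchange_sweedler.
  apply: eq_sweedler => x m0; rewrite [LHS]exchange_sweedler.
  by do 2![apply: eq_sweedler => ? ?]; rewrite !mulrA.
transitivity (\sw_(h1 ⊗ h2 <- comul h) \sw_(h21 ⊗ h22 <- comul h2)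
    \sw_(m0 ⊗ x <- rcoact m) \sw_(n0 ⊗ y <- rcoact (ract n (q h22)))
    ((ract m0 (γ g2 h1) ⊗ n0) ⊗ (x * (γ g2 (q h21) * y)))).
  apply: eq_sweedler => h1 h2; rewrite [LHS]exchange_sweedler [RHS]exchange_sweedler.
  apply: eq_sweedler => m0 x.
  have := ract_rcoact_sw (q h2) n (f := fun n0 y =>
    (ract m0 (γ g2 h1) ⊗ n0) ⊗ (x * y)).
  by move=> E; etransitivity; [etransitivity; [|apply: E; lin]|];
    [symmetry|]; (step ltac:(apply: comul_haut_sw; lin)).
step ltac:(symmetry; apply: comulA_sw; lin).
symmetry; step ltac:(symmetry; apply: comulA_sw; lin); symmetry.
apply: eq_sweedler => h1 h2.
have := ract_rcoact_sw (γ g2 h1) m (f := fun m0 x =>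
    \sw_(n0 ⊗ y <- rcoact (ract n (q h2))) ((m0 ⊗ n0) ⊗ (x * y))).
move=> E; etransitivity; [etransitivity; [|apply: E; lin]|];
    [symmetry|]; (step ltac:(apply: comul_haut_sw; lin));
  do 3![apply: eq_sweedler => ? ?]; cbn beta.
  by rewrite qE mulrA.
by rewrite mulrA.
Qed.

Lemma tens_ract_lcoact h : forall t,
    tens_lcoact (tens_ract t h) = \sw_(x ⊗ m0 <- tens_lcoact t) (x ⊗ tens_ract m0 h).
Proof.
rewrite /tens_ract /tens_lcoact; tens_ext m n; sw_norm.
rewrite [LHS]exchange_sweedler; apply: eq_sweedler => m0 x.
by rewrite [LHS]exchange_sweedler.
Qed.

Lemma tens_lr_axioms :
  lr_axioms (g1 * g2)%g tens_lact tens_ract tens_lcoact tens_rcoact.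
Proof.
split.
- exact: tens_lact_bilin.
- exact: tens_lact1.
- exact: tens_lactM.
- exact: tens_ract_bilin.
- exact: tens_ract1.
- by move=> g h m; exact: tens_ractM.
- by move=> h h' m; exact: tens_bimod.
- exact: tens_lcoact_lin.
- exact: tens_lcoactA.
- exact: tens_lcoact_counit.
- exact: tens_rcoact_lin.
- exact: tens_rcoactA.
- exact: tens_rcoact_counit.
- exact: tens_bicomod.
- exact: tens_lact_lcoact.
- exact: tens_lact_rcoact.
- exact: tens_ract_rcoact.
- exact: tens_ract_lcoact.
Qed.

Definition lr_tens : lrModule H1 H2 := LRModule tens_lr_axioms.

End LRTensor.

Section LRUnit.
Variables (k : fieldType) (H1 H2 : hopfAlgebra k).

Definition unit_lact (h : H1) (x : k^o) : k^o := counit h *: x.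
Definition unit_ract (x : k^o) (h : H2) : k^o := counit h *: x.
Definition unit_lcoact (x : k^o) : H1 ⊗ k^o := 1 ⊗ x.
Definition unit_rcoact (x : k^o) : k^o ⊗ H2 := x ⊗ 1.

Lemma unit_lr_axioms :
  lr_axioms (1%g : lr_index H1 H2) unit_lact unit_ract unit_lcoact unit_rcoact.
Proof.
rewrite /unit_lact /unit_ract /unit_lcoact /unit_rcoact.
split.
- by lin.
- by move=> m; rewrite counit1 scale1r.
- by move=> g h m; rewrite counitM scalerA.
- split; by lin.
- by move=> m; rewrite counit1 scale1r.
- by move=> g h m; rewrite counitM scalerA mulrC.
- by move=> h h' m; rewrite !scalerA mulrC.
- by lin.
- by move=> m; sw_norm.
- by move=> m; sw_norm; rewrite counit1 scale1r.
- by lin.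
- by move=> m; sw_norm.
- by move=> m; sw_norm; rewrite counit1 scale1r.
- by move=> m; sw_norm.
- move=> h m; sw_norm; transitivity (h ⊗ m : H1 ⊗ k^o).
    rewrite -(counitr_sw (f := fun x => x ⊗ m)); last by lin.
    by apply: eq_sweedler => a b; rewrite mulr1 (linear_scale _ _ (pure_linr _)).
  rewrite -(counitl_sw (f := fun x => x ⊗ m)); last by lin.
  by apply: eq_sweedler => a b; rewrite mul1r (linear_scale _ _ (pure_linr _)).
- by move=> h m; sw_norm; rewrite (linear_scale _ _ (pure_linl _)).
- move=> h m; sw_norm; transitivity (m ⊗ h : k^o ⊗ H2).
    rewrite -(counitl_sw (f := fun x => m ⊗ x)); last by lin.
    by apply: eq_sweedler => a b; rewrite mul1r (linear_scale _ _ (pure_linl _)).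
  rewrite -(counitr_sw (f := fun x => m ⊗ x)); last by lin.
  by apply: eq_sweedler => a b; rewrite mulr1 (linear_scale _ _ (pure_linl _)).
- by move=> h m; sw_norm.
Qed.

Definition lr_unit : lrModule H1 H2 := LRModule unit_lr_axioms.
End LRUnit.

Section LRConj.
Variables (k : fieldType) (H1 H2 : hopfAlgebra k) (g : lr_index H1 H2) (N : lrModule H1 H2).
Local Notation α := ix_alpha.
Local Notation β := ix_beta.
Local Notation γ := ix_gamma.
Local Notation δ := ix_delta.
Local Notation g2 := (lr_deg N).

Definition conj_lact (h : H1) (n : N) : N := lact (((β g)^-1 * α g)%g h) n.
Definition conj_lcoact (n : N) : H1 ⊗ N :=
  \sw_(x ⊗ n0 <- lcoact n) ((((α g)^-1 * α g2 * β g * (α g2)^-1)%g x) ⊗ n0).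
Definition conj_ract (n : N) (h : H2) : N :=
  ract n (((γ g2)^-1 * δ g * γ g2 * (γ g)^-1)%g h).
Definition conj_rcoact (n : N) : N ⊗ H2 :=
  \sw_(n0 ⊗ x <- rcoact n) (n0 ⊗ ((γ g * (δ g)^-1)%g x)).

Lemma conj_lr_axioms :
  lr_axioms (g * g2 * g^-1)%g conj_lact conj_ract conj_lcoact conj_rcoact.
Proof.
rewrite /conj_lact /conj_ract /conj_lcoact /conj_rcoact.
set u := ((β g)^-1 * α g)%g.
set v := ((α g)^-1 * α g2 * β g * (α g2)^-1)%g.
set p := ((γ g2)^-1 * δ g * γ g2 * (γ g)^-1)%g.
set w := (γ g * (δ g)^-1)%g.
have Ea : α (g * g2 * g^-1)%g = (v * α g2 * u)%g.
  by rewrite /u /v /= ?invgK ?mulgA !(mulgK, mulgVK).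
have Eb : β (g * g2 * g^-1)%g = (v * β g2 * u)%g.
  by rewrite /u /v /= ?invgK ?mulgA !(mulgK, mulgVK).
have Ec : γ (g * g2 * g^-1)%g = (w * γ g2 * p)%g.
  by rewrite /w /p /= ?invgK ?mulgA !(mulgK, mulgVK).
have Ed : δ (g * g2 * g^-1)%g = (w * δ g2 * p)%g.
  by rewrite /w /p /= ?invgK ?mulgA !(mulgK, mulgVK).
have L := lr_laws N.
split.
- by lin.
- by move=> m; rewrite haut1 (lr_lact1 L).
- by move=> a b m; rewrite hautM (lr_lactM L).
- by lin.
- by move=> m; rewrite haut1 (lr_ract1 L).
- by move=> a b m; rewrite hautM (lr_ractM L).
- by move=> h h' m; rewrite (lr_bimod L).
- by lin.
- by move=> m; sw_norm; apply: lcoactA_sw; lin.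
- move=> m; sw_norm; rewrite -[RHS](lr_lcoact_counit L).
  by apply: eq_sweedler => x n0; rewrite haut_counit.
- by lin.
- by move=> m; sw_norm; apply: rcoactA_sw; lin.
- move=> m; sw_norm; rewrite -[RHS](lr_rcoact_counit L).
  by apply: eq_sweedler => x n0; rewrite haut_counit.
- by move=> m; sw_norm; apply: bicomod_sw; lin.
- move=> h m; sw_norm; rewrite Ea Eb.
  have := lact_lcoact_sw (u h) m (f := fun y n0 => v y ⊗ n0).
  move=> E; etransitivity; [etransitivity; [|apply: E; lin]|];
    [symmetry|]; (etransitivity; [apply: comul_haut_sw; lin|]);
    by do 2![apply: eq_sweedler => ? ?]; cbn beta; rewrite hautM.
- by move=> h m; sw_norm.
- move=> h m; sw_norm; rewrite Ec Ed.
  have := ract_rcoact_sw (p h) m (f := fun n0 y => n0 ⊗ w y).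
  move=> E; etransitivity; [etransitivity; [|apply: E; lin]|];
    [symmetry|]; (etransitivity; [apply: comul_haut_sw; lin|]);
    by do 2![apply: eq_sweedler => ? ?]; cbn beta; rewrite hautM.
- by move=> h m; sw_norm.
Qed.

Definition lr_conj : lrModule H1 H2 := LRModule conj_lr_axioms.
End LRConj.

(* Vector spaces form a monoidal category that is only strict up to the canonical
   associativity and unit isomorphisms, which therefore appear explicitly. *)
Record tcat_data (G : groupType) := TCatData {
  tc_ob :> Type;
  tc_hom : tc_ob -> tc_ob -> Type;
  tc_id : forall X, tc_hom X X;
  tc_comp : forall X Y Z, tc_hom Y Z -> tc_hom X Y -> tc_hom X Z;
  tc_tens : tc_ob -> tc_ob -> tc_ob;
  tc_tens_hom : forall X Y X' Y', tc_hom X X' -> tc_hom Y Y' -> tc_hom (tc_tens X Y) (tc_tens X' Y');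
  tc_one : tc_ob;
  tc_assoc : forall X Y Z, tc_hom (tc_tens (tc_tens X Y) Z) (tc_tens X (tc_tens Y Z));
  tc_assoc_inv : forall X Y Z, tc_hom (tc_tens X (tc_tens Y Z)) (tc_tens (tc_tens X Y) Z);
  tc_lunit : forall X, tc_hom (tc_tens tc_one X) X;
  tc_lunit_inv : forall X, tc_hom X (tc_tens tc_one X);
  tc_runit : forall X, tc_hom (tc_tens X tc_one) X;
  tc_runit_inv : forall X, tc_hom X (tc_tens X tc_one);
  tc_deg : tc_ob -> G;
  tc_conj : G -> tc_ob -> tc_ob;
  tc_conj_hom : forall (a : G) X Y, tc_hom X Y -> tc_hom (tc_conj a X) (tc_conj a Y)
}.

Arguments tc_hom {G t}.
Arguments tc_id {G t}.
Arguments tc_comp {G t X Y Z}.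
Arguments tc_tens {G t}.
Arguments tc_tens_hom {G t X Y X' Y'}.
Arguments tc_one {G t}.
Arguments tc_assoc {G t}.
Arguments tc_assoc_inv {G t}.
Arguments tc_lunit {G t}.
Arguments tc_lunit_inv {G t}.
Arguments tc_runit {G t}.
Arguments tc_runit_inv {G t}.
Arguments tc_deg {G t}.
Arguments tc_conj {G t}.
Arguments tc_conj_hom {G t} a {X Y}.

Declare Scope tcat_scope.
Delimit Scope tcat_scope with TC.
Notation "f ∘ g" := (tc_comp f g) (at level 40, left associativity) : tcat_scope.
Notation "X ⊠ Y" := (tc_tens X Y) (at level 39, left associativity) : tcat_scope.
Notation "f ⊠' g" := (tc_tens_hom f g) (at level 39, left associativity) : tcat_scope.

(* Equality of morphisms whose sources and targets are equal, but not
   necessarily convertible, objects. *)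
Inductive hom_eq (G : groupType) (C : tcat_data G) (X Y : C) (f : tc_hom X Y) :
  forall X' Y' : C, tc_hom X' Y' -> Prop := hom_eq_refl : hom_eq f f.
Notation "f ≃ g" := (hom_eq f g) (at level 70, no associativity) : tcat_scope.

Local Open Scope tcat_scope.

Section TCat.
Variables (G : groupType) (C : tcat_data G).
Implicit Types (a b : G) (W X Y Z : C).

Definition is_inverse X Y (f : tc_hom X Y) (g : tc_hom Y X) : Prop :=
  g ∘ f = tc_id X /\ f ∘ g = tc_id Y.

Record is_category : Prop := {
  tc_comp_id : forall X Y (f : tc_hom X Y), f ∘ tc_id X = f;
  tc_id_comp : forall X Y (f : tc_hom X Y), tc_id Y ∘ f = f;
  tc_compA : forall W X Y Z (f : tc_hom Y Z) (g : tc_hom X Y) (h : tc_hom W X),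
    f ∘ (g ∘ h) = f ∘ g ∘ h
}.

Record is_monoidal : Prop := {
  tc_tens_id : forall X Y, tc_id X ⊠' tc_id Y = tc_id (X ⊠ Y);
  tc_tens_comp : forall X Y Z X' Y' Z'
      (f : tc_hom Y Z) (g : tc_hom X Y) (f' : tc_hom Y' Z') (g' : tc_hom X' Y'),
    (f ∘ g) ⊠' (f' ∘ g') = (f ⊠' f') ∘ (g ⊠' g');
  tc_assoc_iso : forall X Y Z, is_inverse (tc_assoc X Y Z) (tc_assoc_inv X Y Z);
  tc_assoc_nat : forall X Y Z X' Y' Z' (f : tc_hom X X') (g : tc_hom Y Y') (h : tc_hom Z Z'),
    tc_assoc X' Y' Z' ∘ (f ⊠' g ⊠' h) = (f ⊠' (g ⊠' h)) ∘ tc_assoc X Y Z;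
  tc_lunit_iso : forall X, is_inverse (tc_lunit X) (tc_lunit_inv X);
  tc_lunit_nat : forall X Y (f : tc_hom X Y), tc_lunit Y ∘ (tc_id tc_one ⊠' f) = f ∘ tc_lunit X;
  tc_runit_iso : forall X, is_inverse (tc_runit X) (tc_runit_inv X);
  tc_runit_nat : forall X Y (f : tc_hom X Y), tc_runit Y ∘ (f ⊠' tc_id tc_one) = f ∘ tc_runit X;
  tc_pentagon : forall W X Y Z,
    tc_assoc W X (Y ⊠ Z) ∘ tc_assoc (W ⊠ X) Y Z =
    (tc_id W ⊠' tc_assoc X Y Z) ∘ tc_assoc W (X ⊠ Y) Z ∘ (tc_assoc W X Y ⊠' tc_id Z);
  tc_triangle : forall X Y,
    (tc_id X ⊠' tc_lunit Y) ∘ tc_assoc X tc_one Y = tc_runit X ⊠' tc_id Y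
}.

(* [C] is the disjoint union of the subcategories of objects of a given degree,
   there being no morphism between objects of different degrees. *)
Record is_graded : Prop := {
  tc_hom_deg : forall X Y, tc_hom X Y -> tc_deg X = tc_deg Y;
  tc_deg_tens : forall X Y, tc_deg (X ⊠ Y) = (tc_deg X * tc_deg Y)%g
}.

(* [cob a] and [chom a] form a strict tensor functor, and [a |-> (cob a, chom a)]
   is multiplicative and unital, so that these functors are invertible. *)
Record is_conjugation : Prop := {
  tc_conj_id : forall a X, tc_conj_hom a (tc_id X) = tc_id (tc_conj a X);
  tc_conj_comp : forall a X Y Z (f : tc_hom Y Z) (g : tc_hom X Y),
    tc_conj_hom a (f ∘ g) = tc_conj_hom a f ∘ tc_conj_hom a g;
  tc_conj_tens : forall a X Y, tc_conj a (X ⊠ Y) = tc_conj a X ⊠ tc_conj a Y;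
  tc_conj_tens_hom : forall a X Y X' Y' (f : tc_hom X X') (g : tc_hom Y Y'),
    tc_conj_hom a (f ⊠' g) ≃ tc_conj_hom a f ⊠' tc_conj_hom a g;
  tc_conj_one : forall a, tc_conj a tc_one = tc_one :> C;
  tc_conj_assoc : forall a X Y Z,
    tc_conj_hom a (tc_assoc X Y Z) ≃ tc_assoc (tc_conj a X) (tc_conj a Y) (tc_conj a Z);
  tc_conj_lunit : forall a X, tc_conj_hom a (tc_lunit X) ≃ tc_lunit (tc_conj a X);
  tc_conj_runit : forall a X, tc_conj_hom a (tc_runit X) ≃ tc_runit (tc_conj a X);
  tc_conjM : forall a b X, tc_conj (a * b)%g X = tc_conj a (tc_conj b X);
  tc_conj_homM : forall a b X Y (f : tc_hom X Y), tc_conj_hom (a * b)%g f ≃ tc_conj_hom a (tc_conj_hom b f);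
  tc_conj1 : forall X, tc_conj 1%g X = X;
  tc_conj_hom1 : forall X Y (f : tc_hom X Y), tc_conj_hom 1%g f ≃ f;
  tc_deg_conj : forall a b X,
    tc_deg X = (b * a * b^-1)%g <-> exists2 Y, tc_deg Y = a & X = tc_conj b Y
}.

Record is_crossed_tcategory : Prop := {
  crossed_category :> is_category;
  crossed_monoidal :> is_monoidal;
  crossed_graded :> is_graded;
  crossed_conjugation :> is_conjugation
}.

(* Conjugation of [Y] by the degree of [X]. *)
Local Notation "X ⋆ Y" := (tc_conj (tc_deg X) Y) (at level 38, right associativity).

Record is_braiding (c : forall X Y : C, tc_hom (X ⊠ Y) (X ⋆ Y ⊠ X)) : Prop := {
  braid_iso : forall X Y, exists d, is_inverse (c X Y) d;
  braid_nat : forall X Y X' Y' (f : tc_hom X X') (g : tc_hom Y Y'),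
    (tc_conj_hom (tc_deg X) g ⊠' f) ∘ c X Y ≃ c X' Y' ∘ (f ⊠' g);
  braid_tensl : forall X Y Z,
    c (X ⊠ Y) Z ≃
    tc_assoc _ _ _ ∘ (c X (Y ⋆ Z) ⊠' tc_id Y) ∘ tc_assoc_inv _ _ _ ∘
      (tc_id X ⊠' c Y Z) ∘ tc_assoc _ _ _;
  braid_tensr : forall X Y Z,
    c X (Y ⊠ Z) ≃
    tc_assoc_inv _ _ _ ∘ (tc_id (X ⋆ Y) ⊠' c X Z) ∘ tc_assoc _ _ _ ∘
      (c X Y ⊠' tc_id Z) ∘ tc_assoc_inv _ _ _;
  braid_conj : forall a X Y, tc_conj_hom a (c X Y) ≃ c (tc_conj a X) (tc_conj a Y)
}.

Definition is_left_dual X Xd (ev : tc_hom (Xd ⊠ X) tc_one) (coev : tc_hom tc_one (X ⊠ Xd)) : Prop :=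
  tc_runit X ∘ (tc_id X ⊠' ev) ∘ tc_assoc X Xd X ∘ (coev ⊠' tc_id X) ∘ tc_lunit_inv X = tc_id X /\
  tc_lunit Xd ∘ (ev ⊠' tc_id Xd) ∘ tc_assoc_inv Xd X Xd ∘ (tc_id Xd ⊠' coev) ∘ tc_runit_inv Xd = tc_id Xd.

Definition is_right_dual X Xd (ev : tc_hom (X ⊠ Xd) tc_one) (coev : tc_hom tc_one (Xd ⊠ X)) : Prop :=
  tc_lunit X ∘ (ev ⊠' tc_id X) ∘ tc_assoc_inv X Xd X ∘ (tc_id X ⊠' coev) ∘ tc_runit_inv X = tc_id X /\
  tc_runit Xd ∘ (tc_id Xd ⊠' ev) ∘ tc_assoc Xd X Xd ∘ (coev ⊠' tc_id Xd) ∘ tc_lunit_inv Xd = tc_id Xd.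

Definition is_rigid : Prop := forall X,
  (exists Xd ev coev, @is_left_dual X Xd ev coev) /\
  (exists Xd ev coev, @is_right_dual X Xd ev coev).

Record is_rigid_braided_tcategory (c : forall X Y : C, tc_hom (X ⊠ Y) (X ⋆ Y ⊠ X)) : Prop := {
  rbt_crossed :> is_crossed_tcategory;
  rbt_braiding : is_braiding c;
  rbt_rigid : is_rigid
}.

End TCat.

Section LRCategory.
Variables (k : fieldType) (H1 H2 : hopfAlgebra k).
Local Notation LR := (lrModule H1 H2).
Implicit Types (L M N P : LR).

(* [lr_hom_deg]: there is no morphism between modules of different index. *)
Record lr_hom_axioms M N (f : M -> N) : Prop := {
  lr_hom_deg : lr_deg M = lr_deg N;
  lr_hom_linear : linear f;
  lr_hom_lact : forall h m, f (lact h m) = lact h (f m);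
  lr_hom_ract : forall h m, f (ract m h) = ract (f m) h;
  lr_hom_lcoact : forall m, lcoact (f m) = \sw_(x ⊗ m0 <- lcoact m) (x ⊗ f m0);
  lr_hom_rcoact : forall m, rcoact (f m) = \sw_(m0 ⊗ x <- rcoact m) (f m0 ⊗ x)
}.

Record lr_hom M N := LRHom {
  lr_fun :> M -> N;
  lr_fun_axioms : lr_hom_axioms lr_fun
}.

Lemma lr_hom_lin M N (f : lr_hom M N) : linear (lr_fun f).
Proof. exact: lr_hom_linear (lr_fun_axioms f). Qed.

Lemma lcoact_hom_sw M N (f : lr_hom M N) (U : lmodType k) (F : H1 -> N -> U) m : bilin F ->
  \sw_(x ⊗ m0 <- lcoact (f m)) F x m0 = \sw_(x ⊗ m0 <- lcoact m) F x (f m0).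
Proof. by move=> bF; rewrite (lr_hom_lcoact (lr_fun_axioms f)); sw_norm. Qed.
Lemma rcoact_hom_sw M N (f : lr_hom M N) (U : lmodType k) (F : N -> H2 -> U) m : bilin F ->
  \sw_(m0 ⊗ x <- rcoact (f m)) F m0 x = \sw_(m0 ⊗ x <- rcoact m) F (f m0) x.
Proof. by move=> bF; rewrite (lr_hom_rcoact (lr_fun_axioms f)); sw_norm. Qed.

Lemma lr_homP M N (f g : lr_hom M N) : f =1 g -> f = g.
Proof.
case: f g => f fP [g gP] /= /funext fg; rewrite -{}fg in gP *.
by congr LRHom; exact: Prop_irrelevance.
Qed.
End LRCategory.

Ltac lin_extra ::=
  lazymatch goal with
  | |- linear (haut _) => apply: haut_lin
  | |- linear (fun x => haut _ x) => apply: haut_lin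
  | |- linear (lr_fun _) => apply: lr_hom_lin
  | |- linear (fun x => lr_fun _ x) => apply: lr_hom_lin
  | |- linear (fun x => lact x _) => apply: lact_linl
  | |- linear (lact _) => apply: lact_linr
  | |- linear (fun x => lact _ x) => apply: lact_linr
  | |- linear (fun x => ract _ x) => apply: ract_linr
  | |- linear (fun x => ract x _) => apply: ract_linl
  | |- linear (ract _) => apply: ract_linr
  | |- linear (@lcoact _ _ _ _) => apply: lcoact_lin
  | |- linear (@rcoact _ _ _ _) => apply: rcoact_lin
  | |- linear (fun x => lcoact x) => apply: lcoact_lin
  | |- linear (fun x => rcoact x) => apply: rcoact_lin
  end.

Ltac sw_rule ::=
  lazymatch goal with
  | |- sweedler (@GRing.Linear.sort _ _ _ _ _ (haut _ _)) _ = _ => apply: comul_haut_sw; lin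
  | |- sweedler (@GRing.Linear.sort _ _ _ _ _ (GRing.mul _ _)) _ = _ => apply: comulM_sw; lin
  | |- sweedler (@GRing.Linear.sort _ _ _ _ _ (GRing.one _)) _ = _ => apply: comul1_sw; lin
  | |- sweedler (rcoact (lact _ _)) _ = _ => apply: lact_rcoact_sw; lin
  | |- sweedler (lcoact (ract _ _)) _ = _ => apply: ract_lcoact_sw; lin
  | |- sweedler (lcoact (lr_fun _ _)) _ = _ => apply: lcoact_hom_sw; lin
  | |- sweedler (rcoact (lr_fun _ _)) _ = _ => apply: rcoact_hom_sw; lin
  end.

Ltac tens_ext m n :=
  let t := fresh in intro t; move: t; apply: tens_lin_ext; [lin | lin | move=> m n].

Section LRCategory2.
Variables (k : fieldType) (H1 H2 : hopfAlgebra k).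
Local Notation LR := (lrModule H1 H2).
Implicit Types (L M N P : LR).

Lemma lr_id_axioms M : lr_hom_axioms (M := M) (N := M) id.
Proof. by split=> // m; exact: pure_spans. Qed.
Definition lr_id M : lr_hom M M := LRHom (lr_id_axioms M).

Lemma lr_comp_axioms L M N (f : lr_hom M N) (g : lr_hom L M) :
  lr_hom_axioms (fun m => f (g m)).
Proof.
have [Fd _ Fl Fr Flc Frc] := lr_fun_axioms f; have [Gd _ Gl Gr Glc Grc] := lr_fun_axioms g.
split=> [||h m|h m|m|m]; first by rewrite Gd.
- by lin.
- by rewrite Gl Fl.
- by rewrite Gr Fr.
- by rewrite Flc; sw_norm.
- by rewrite Frc; sw_norm.
Qed.
Definition lr_comp L M N (f : lr_hom M N) (g : lr_hom L M) : lr_hom L N :=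
  LRHom (lr_comp_axioms f g).

Definition tens_map (U V U' V' : lmodType k) (f : U -> U') (g : V -> V')
    (t : U ⊗ V) : U' ⊗ V' :=
  \sw_(u ⊗ v <- t) (f u ⊗ g v).

Lemma lr_tens_hom_axioms M N M' N' (f : lr_hom M M') (g : lr_hom N N') :
  lr_hom_axioms (M := lr_tens M N) (N := lr_tens M' N') (tens_map f g).
Proof.
have [Fd _ Fl Fr Flc Frc] := lr_fun_axioms f; have [Gd _ Gl Gr Glc Grc] := lr_fun_axioms g.
split=> /= [||h|h||]; rewrite /tens_map ?/tens_lact ?/tens_ract ?/tens_lcoact ?/tens_rcoact.
- by rewrite Fd Gd.
- by lin.
- tens_ext m n; sw_norm; apply: eq_sweedler => a b; by rewrite Fl Gl.
- tens_ext m n; sw_norm; apply: eq_sweedler => a b; by rewrite Fr Gr Fd Gd.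
- by tens_ext m n; sw_norm; rewrite Fd Gd.
- by tens_ext m n; sw_norm.
Qed.
Definition lr_tens_hom M N M' N' (f : lr_hom M M') (g : lr_hom N N') :
  lr_hom (lr_tens M N) (lr_tens M' N') := LRHom (lr_tens_hom_axioms f g).

Lemma lr_conj_hom_axioms (g : lr_index H1 H2) M N (f : lr_hom M N) :
  lr_hom_axioms (M := lr_conj g M) (N := lr_conj g N) f.
Proof.
have [Fd _ Fl Fr Flc Frc] := lr_fun_axioms f.
split=> /= [||h m|h m|m|m]; rewrite ?/conj_lact ?/conj_ract ?/conj_lcoact ?/conj_rcoact.
- by rewrite Fd.
- exact: lr_hom_lin.
- by rewrite Fl.
- by rewrite Fr Fd.
- by sw_norm; rewrite Fd.
- by sw_norm.
Qed.
Definition lr_conj_hom (g : lr_index H1 H2) M N (f : lr_hom M N) :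
  lr_hom (lr_conj g M) (lr_conj g N) := LRHom (lr_conj_hom_axioms g f).

Definition tens_assoc (U V W : lmodType k) (t : U ⊗ V ⊗ W) : U ⊗ (V ⊗ W) :=
  \sw_(s ⊗ w <- t) \sw_(u ⊗ v <- s) (u ⊗ (v ⊗ w)).
Definition tens_assoc_inv (U V W : lmodType k) (t : U ⊗ (V ⊗ W)) : U ⊗ V ⊗ W :=
  \sw_(u ⊗ s <- t) \sw_(v ⊗ w <- s) (u ⊗ v ⊗ w).
Definition tens_lunit (U : lmodType k) (t : k^o ⊗ U) : U :=
  \sw_(a ⊗ u <- t) ((a : k) *: u).
Definition tens_lunit_inv (U : lmodType k) (u : U) : k^o ⊗ U := 1 ⊗ u.
Definition tens_runit (U : lmodType k) (t : U ⊗ k^o) : U :=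
  \sw_(u ⊗ a <- t) ((a : k) *: u).
Definition tens_runit_inv (U : lmodType k) (u : U) : U ⊗ k^o := u ⊗ 1.

Lemma tens_lin_ext3l (U V W X : lmodType k) (f g : U ⊗ V ⊗ W -> X) :
  linear f -> linear g -> (forall u v w, f (u ⊗ v ⊗ w) = g (u ⊗ v ⊗ w)) -> f =1 g.
Proof.
move=> lf lg fg; apply: tens_lin_ext => // s w; move: s.
apply: tens_lin_ext => [||u v]; last exact: fg.
  exact: (comp_linear lf (pure_linl w)).
exact: (comp_linear lg (pure_linl w)).
Qed.
Lemma tens_lin_ext3r (U V W X : lmodType k) (f g : U ⊗ (V ⊗ W) -> X) :
  linear f -> linear g -> (forall u v w, f (u ⊗ (v ⊗ w)) = g (u ⊗ (v ⊗ w))) -> f =1 g.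
Proof.
move=> lf lg fg; apply: tens_lin_ext => // u s; move: s.
apply: tens_lin_ext => [||v w]; last exact: fg.
  exact: (comp_linear lf (pure_linr u)).
exact: (comp_linear lg (pure_linr u)).
Qed.

Lemma lr_inv_axioms M N (f : M -> N) (g : N -> M) :
  lr_hom_axioms f -> linear g -> cancel f g -> cancel g f -> lr_hom_axioms g.
Proof.
move=> fP lg fK gK; have [Fd lf Fl Fr Flc Frc] := fP.
have gf (U : lmodType k) (F : U -> M) : (fun u => g (f (F u))) = F by apply/funext => u; rewrite fK.
split=> // [h m|h m|m|m].
- by rewrite -{1}[m]gK -Fl fK.
- by rewrite -{1}[m]gK -Fr fK.
- rewrite -{2}[m]gK Flc; sw_norm.
  by rewrite [LHS]pure_spans; apply: eq_sweedler => x m0; rewrite fK.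
- rewrite -{2}[m]gK Frc; sw_norm.
  by rewrite [LHS]pure_spans; apply: eq_sweedler => x m0; rewrite fK.
Qed.

Ltac lr_unfold :=
  rewrite /tens_assoc /tens_lunit /tens_runit;
  cbn [lact ract lcoact rcoact lr_deg lr_space lr_tens lr_unit];
  rewrite ?/tens_lact ?/tens_ract ?/tens_lcoact ?/tens_rcoact;
  cbn [lact ract lcoact rcoact lr_deg lr_space lr_tens lr_unit];
  rewrite ?/tens_lact ?/tens_ract ?/tens_lcoact ?/tens_rcoact
    ?/unit_lact ?/unit_ract ?/unit_lcoact ?/unit_rcoact.
Ltac tens_ext3 m n p :=
  let t := fresh in intro t; move: t; apply: tens_lin_ext3l; [lin|lin|move=> m n p].

Lemma lr_assoc_axioms M N P :
  lr_hom_axioms (M := lr_tens (lr_tens M N) P) (N := lr_tens M (lr_tens N P))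
    (@tens_assoc M N P).
Proof.
split=> [||h|h||]; lr_unfold.
- by rewrite mulgA.
- by lin.
- by tens_ext3 m n p; sw_norm; apply: comulA_sw; lin.
- tens_ext3 m n p; sw_norm.
  etransitivity; [apply: comulA_sw; lin|].
  do 2![apply: eq_sweedler => ? ?]. by rewrite /= ?hautK ?hautVK.
- tens_ext3 m n p; sw_norm.
  apply: eq_sweedler => ? ?; apply: eq_sweedler => ? ?; apply: eq_sweedler => ? ?.
  by rewrite !hautM /= !hautK ?mulrA.
- tens_ext3 m n p; sw_norm.
  by do 3![apply: eq_sweedler => ? ?]; rewrite mulrA.
Qed.
Definition lr_assoc M N P : lr_hom (lr_tens (lr_tens M N) P) (lr_tens M (lr_tens N P)) :=
  LRHom (lr_assoc_axioms M N P).

Lemma tens_assocK (U V W : lmodType k) : cancel (@tens_assoc U V W) (@tens_assoc_inv U V W).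
Proof.
by rewrite /cancel /tens_assoc /tens_assoc_inv; tens_ext3 u v w; sw_norm.
Qed.
Lemma tens_assoc_invK (U V W : lmodType k) : cancel (@tens_assoc_inv U V W) (@tens_assoc U V W).
Proof.
rewrite /cancel /tens_assoc /tens_assoc_inv => t; move: t.
by apply: tens_lin_ext3r; [lin|lin|move=> u v w]; sw_norm.
Qed.
Lemma tens_assoc_inv_lin (U V W : lmodType k) : linear (@tens_assoc_inv U V W).
Proof. by rewrite /tens_assoc_inv; lin. Qed.

Definition lr_assoc_inv M N P :
    lr_hom (lr_tens M (lr_tens N P)) (lr_tens (lr_tens M N) P) :=
  LRHom (lr_inv_axioms (lr_assoc_axioms M N P) (@tens_assoc_inv_lin M N P)
           (@tens_assocK M N P) (@tens_assoc_invK M N P)).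

Lemma lr_lunit_axioms M :
  lr_hom_axioms (M := lr_tens (lr_unit H1 H2) M) (N := M) (@tens_lunit M).
Proof.
split=> [||h|h||]; lr_unfold.
- by rewrite mul1g.
- by lin.
- tens_ext a m; sw_norm.
  etransitivity; last by apply: (counitl_sw (f := fun x => lact x (a *: m))); lin.
  by apply: eq_sweedler => x y; rewrite (linear_scale _ _ (lact_linr _)) scalerA.
- tens_ext a m; sw_norm.
  etransitivity; last by apply: (counitl_sw (f := fun x => ract (a *: m) x)); lin.
  apply: eq_sweedler => x y.
  by rewrite (linear_scale _ _ (ract_linl _)) scalerA haut_counit /= hautK.
- tens_ext a m; sw_norm.
  rewrite (linear_scale _ _ (@lcoact_lin _ _ _ _)) pure_spansZ; apply: eq_sweedler => x m0.
  by rewrite haut1 mul1r /= hautVK (linear_scale _ _ (pure_linr _)).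
- tens_ext a m; sw_norm.
  rewrite (linear_scale _ _ (@rcoact_lin _ _ _ _)) pure_spansZ; apply: eq_sweedler => m0 x.
  by rewrite mul1r (linear_scale _ _ (pure_linl _)).
Qed.
Definition lr_lunit M : lr_hom (lr_tens (lr_unit H1 H2) M) M := LRHom (lr_lunit_axioms M).

Lemma lr_runit_axioms M :
  lr_hom_axioms (M := lr_tens M (lr_unit H1 H2)) (N := M) (@tens_runit M).
Proof.
split=> [||h|h||]; lr_unfold.
- by rewrite mulg1.
- by lin.
- tens_ext m a; sw_norm.
  etransitivity; last by apply: (counitr_sw (f := fun x => lact x (a *: m))); lin.
  by apply: eq_sweedler => x y; rewrite (linear_scale _ _ (lact_linr _)) scalerA.
- tens_ext m a; sw_norm.
  etransitivity; last by apply: (counitr_sw (f := fun x => ract (a *: m) x)); lin.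
  apply: eq_sweedler => x y.
  by rewrite (linear_scale _ _ (ract_linl _)) scalerA !haut_counit.
- tens_ext m a; sw_norm.
  rewrite (linear_scale _ _ (@lcoact_lin _ _ _ _)) pure_spansZ; apply: eq_sweedler => x m0.
  by rewrite haut1 mulr1 (linear_scale _ _ (pure_linr _)).
- tens_ext m a; sw_norm.
  rewrite (linear_scale _ _ (@rcoact_lin _ _ _ _)) pure_spansZ; apply: eq_sweedler => m0 x.
  by rewrite mulr1 (linear_scale _ _ (pure_linl _)).
Qed.
Definition lr_runit M : lr_hom (lr_tens M (lr_unit H1 H2)) M := LRHom (lr_runit_axioms M).

Lemma tens_lunitK (U : lmodType k) : cancel (@tens_lunit U) (@tens_lunit_inv U).
Proof.
rewrite /cancel /tens_lunit /tens_lunit_inv; tens_ext a u; sw_norm.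
by rewrite (linear_scale _ _ (pure_linr _)) -(linear_scale _ _ (pure_linl _)) /GRing.scale /= mulr1.
Qed.
Lemma tens_lunit_invK (U : lmodType k) : cancel (@tens_lunit_inv U) (@tens_lunit U).
Proof.
by move=> u; rewrite /tens_lunit /tens_lunit_inv; sw_norm; rewrite scale1r.
Qed.
Lemma tens_runitK (U : lmodType k) : cancel (@tens_runit U) (@tens_runit_inv U).
Proof.
rewrite /cancel /tens_runit /tens_runit_inv; tens_ext u a; sw_norm.
by rewrite (linear_scale _ _ (pure_linl _)) -(linear_scale _ _ (pure_linr _)) /GRing.scale /= mulr1.
Qed.
Lemma tens_runit_invK (U : lmodType k) : cancel (@tens_runit_inv U) (@tens_runit U).
Proof.
by move=> u; rewrite /tens_runit /tens_runit_inv; sw_norm; rewrite scale1r.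
Qed.

Definition lr_lunit_inv M : lr_hom M (lr_tens (lr_unit H1 H2) M) :=
  LRHom (lr_inv_axioms (lr_lunit_axioms M) (pure_linr _)
           (@tens_lunitK M) (@tens_lunit_invK M)).
Definition lr_runit_inv M : lr_hom M (lr_tens M (lr_unit H1 H2)) :=
  LRHom (lr_inv_axioms (lr_runit_axioms M) (pure_linl _)
           (@tens_runitK M) (@tens_runit_invK M)).

End LRCategory2.

Section FiniteDim.
Variable k : fieldType.

Definition fin_dim (V : lmodType k) : Prop := exists n, inhabited (Vector.axiom n V).

Lemma fin_dim_unit : fin_dim k^o.
Proof.
exists 1%N; constructor; exists (fun a => const_mx a).
  by move=> a x y; apply/matrixP => i j; rewrite !mxE.
exists (fun A : 'rV_1 => A 0 0) => [a|A]; first by rewrite mxE.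
by apply/rowP => i; rewrite mxE (ord1 i).
Qed.

Lemma lin_sum (U V : lmodType k) (f : U -> V) (I : Type) (r : seq I) (F : I -> U) :
  linear f -> f (\sum_(i <- r) F i) = \sum_(i <- r) f (F i).
Proof.
move=> lf; elim: r => [|i r IH]; last by rewrite !big_cons -IH -[F i in LHS]scale1r lf scale1r.
by rewrite !big_nil; have := linear_scale 0 0 lf; rewrite !scale0r.
Qed.

Lemma fin_dim_tens (V W : lmodType k) : fin_dim V -> fin_dim W -> fin_dim (V ⊗ W)%type.
Proof.
move=> [m [[f lf [f' fK f'K]]]] [n [[g lg [g' gK g'K]]]].
have lf' : linear f' by move=> a x y; apply: (can_inj fK); rewrite lf !f'K.
have lg' : linear g' by move=> a x y; apply: (can_inj gK); rewrite lg !g'K.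
have bB : bilin (fun v w => (f v)^T *m g w : 'M_(m, n)).
  split=> [w|v] a x y; first by rewrite lf linearP mulmxDl -scalemxAl.
  by rewrite lg mulmxDr -scalemxAr.
pose F t : 'M_(m, n) := \sw_(v ⊗ w <- t) ((f v)^T *m g w).
have lF : linear F by exact: sweedler_linear.
pose F' (A : 'M[k]_(m, n)) : (V ⊗ W)%type :=
  \sum_(i < m) \sum_(j < n) A i j *: (f' (delta_mx 0 i) ⊗ g' (delta_mx 0 j)).
have lF' : linear F'.
  move=> a A B; rewrite /F' scaler_sumr -big_split; apply: eq_bigr => i _ /=.
  rewrite scaler_sumr -big_split; apply: eq_bigr => j _ /=.
  by rewrite !mxE scalerDl scalerA.
have FK : cancel F F'.
  rewrite /cancel; move=> t; move: t; apply: tens_lin_ext => [||v w]; [exact: comp_linear|by []|].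
  rewrite /F sweedler_pure // /F' -{2}[v]fK -{2}[w]gK.
  rewrite [f v in RHS]row_sum_delta (lin_sum _ _ lf') (lin_sum _ _ (pure_linl _)).
  apply: eq_bigr => i _; rewrite (linear_scale _ _ lf') (linear_scale _ _ (pure_linl _)).
  rewrite [g w in RHS]row_sum_delta (lin_sum _ _ lg') (lin_sum _ _ (pure_linr _)) scaler_sumr.
  apply: eq_bigr => j _; rewrite (linear_scale _ _ lg') (linear_scale _ _ (pure_linr _)) scalerA.
  by rewrite !mxE big_ord1 !mxE.
have F'K : cancel F' F.
  move=> A; rewrite /F' (lin_sum _ _ lF) [RHS]matrix_sum_delta; apply: eq_bigr => i _.
  rewrite (lin_sum _ _ lF); apply: eq_bigr => j _.
  by rewrite (linear_scale _ _ lF) /F sweedler_pure // f'K g'K trmx_delta mul_delta_mx.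
exists (m * n)%N; constructor; exists (fun t => mxvec (F t)).
  by move=> a x y; rewrite lF linearP.
exists (fun u => F' (vec_mx u)) => [t|u]; first by rewrite mxvecK FK.
by rewrite F'K vec_mxK.
Qed.
End FiniteDim.

Section LRfd.
Variables (k : fieldType) (H1 H2 : hopfAlgebra k).

Record lrfdModule := LRfdModule {
  lrfd_val :> lrModule H1 H2;
  lrfd_fin_dim : fin_dim lrfd_val
}.
Implicit Types M N : lrfdModule.

Definition lrfd_tens M N : lrfdModule :=
  @LRfdModule (lr_tens M N) (fin_dim_tens (lrfd_fin_dim M) (lrfd_fin_dim N)).
Definition lrfd_unit : lrfdModule := @LRfdModule (lr_unit H1 H2) (fin_dim_unit k).
Definition lrfd_conj (g : lr_index H1 H2) M : lrfdModule :=
  @LRfdModule (lr_conj g M) (lrfd_fin_dim M).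

Definition LRfd : tcat_data (lr_index H1 H2) := {|
  tc_ob := lrfdModule;
  tc_hom := fun M N => lr_hom M N;
  tc_id := fun M => lr_id M;
  tc_comp := fun L M N f g => lr_comp f g;
  tc_tens := lrfd_tens;
  tc_tens_hom := fun M N M' N' f g => lr_tens_hom f g;
  tc_one := lrfd_unit;
  tc_assoc := fun M N P => lr_assoc M N P;
  tc_assoc_inv := fun M N P => lr_assoc_inv M N P;
  tc_lunit := fun M => lr_lunit M;
  tc_lunit_inv := fun M => lr_lunit_inv M;
  tc_runit := fun M => lr_runit M;
  tc_runit_inv := fun M => lr_runit_inv M;
  tc_deg := fun M => lr_deg M;
  tc_conj := lrfd_conj;
  tc_conj_hom := fun g M N f => lr_conj_hom g f
|}.
End LRfd.

(* Main.v *)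
Require Import Defs.
From HB Require Import structures.
From mathcomp Require Import all_boot all_algebra.
From mathcomp Require Import boolp.

(* The braiding is invertible because c is the composite of
   m ⊗ n |-> m_(-1) n ⊗ m_(0) and of its analogue for the right structures, up to
   automorphisms; each factor is undone by the inverse t of the antipode s, as
   h_2 t(h_1) = t(h_2) h_1 = ε(h).  The other axioms are computations in the index
   group, since conjugation changes the structure maps of an object but neither its
   space nor the morphisms.

   The left dual of M is the dual space with the structure maps transposed along s
   for the left action and right coaction, and along t for the right action and left
   coaction, twisted by automorphisms.  Only antimultiplicativity and
   anticomultiplicativity are used, so exchanging s and t gives another object N; the
   pairing of N and M, read backwards, exhibits M as the left dual of N, so N is a
   right dual of M. *)

Set Implicit Arguments.
Unset Strict Implicit.
Unset Printing Implicit Defensive.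

Import GRing.Theory.
Local Open Scope ring_scope.

(** * Antipodes *)

Section Antipode.
Variables (k : fieldType) (H : hopfAlgebra k).
Implicit Types (h : H).

Lemma antipodel_sw (U : lmodType k) (L : H -> U) h : linear L ->
  \sw_(a ⊗ b <- comul h) L (antipode a * b) = counit h *: L 1.
Proof. by move=> lL; rewrite -(linear_scale _ _ lL) -antipodel (linear_sweedler _ _ lL). Qed.

Lemma antipoder_sw (U : lmodType k) (L : H -> U) h : linear L ->
  \sw_(a ⊗ b <- comul h) L (a * antipode b) = counit h *: L 1.
Proof. by move=> lL; rewrite -(linear_scale _ _ lL) -antipoder (linear_sweedler _ _ lL). Qed.

Lemma antipode1 : antipode 1 = 1 :> H.
Proof.
have := antipodel (1 : H); rewrite comul1_sw; last by lin.
by rewrite mulr1 counit1 scale1r.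
Qed.

(** Applying ε to S(h_1) h_2 = ε(h) gives ε(h_2) ε(S(h_1)) = ε(h), and the counit law absorbs
    h_2. *)
Lemma counit_antipode h : counit (antipode h) = counit h.
Proof.
have := antipodel_sw h (L := fun x => counit x : k^o).
rewrite counit1 [_ *: _]mulr1 => <-; last by move=> a x y; rewrite linearP.
under eq_sweedler => a b do rewrite counitM mulrC.
by symmetry; apply: (@counitr_sw k H k^o (fun x => counit (antipode x))) => a x y; rewrite !linearP.
Qed.

Lemma antipodeM (g h : H) : antipode (g * h) = antipode h * antipode g.
Proof.
(* Both sides equal S(a_1 b_1) a_2 b_2 S(b_3) S(a_3). *)
pose E := \sw_(a1 ⊗ a' <- comul g) \sw_(a2 ⊗ a3 <- comul a')
  \sw_(b1 ⊗ b' <- comul h) \sw_(b2 ⊗ b3 <- comul b')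
  antipode (a1 * b1) * (a2 * b2) * (antipode b3 * antipode a3).
transitivity E; last first.
  (* With a_1, a_2 grouped into a' and b_1, b_2 into b', the factor S(a_1 b_1) a_2 b_2 contracts by
     the antipode law at a' b'. *)
  rewrite /E -comulA_sw; try lin.
  etransitivity; last by apply: (counitl_sw (f := fun x => antipode h * antipode x)); lin.
  apply: eq_sweedler => a' a3.
  have <- := counitl_sw (f := fun y => antipode y * antipode a3) h; last by lin.
  rewrite linear_sweedler; last by lin.
  etransitivity.
    by apply: eq_sweedler => a1 a2; rewrite -comulA_sw; [reflexivity|lin|lin|lin].
  rewrite exchange_sweedler; apply: eq_sweedler => b' b3.
  rewrite scalerA -counitM.
  have := antipodel_sw (a' * b') (L := fun x => x * (antipode b3 * antipode a3)).
  by rewrite mul1r => <-; [rewrite comulM_sw//; lin | lin].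
rewrite /E; symmetry.
etransitivity; last by apply: (counitr_sw (f := fun x => antipode (x * h))); lin.
apply: eq_sweedler => a1 a'.
have <- := counitr_sw (f := fun y => antipode (a1 * y)) h; last by lin.
rewrite exchange_sweedler linear_sweedler; last by lin.
apply: eq_sweedler => b1 b'.
(* The inserted units are expanded as counits: first into a_2 S(a_3), then into b_2 S(b_3) between
   its two factors. *)
rewrite -[antipode (a1 * b1) in RHS]mulr1 -[in RHS](mul1r 1).
have := antipoder_sw a' (L := fun x => counit b' *: (antipode (a1 * b1) * x)).
rewrite mul1r mulr1 => <-; last by lin.
apply: eq_sweedler => a2 a3.
have := antipoder_sw b' (L := fun x => (antipode (a1 * b1) * (a2 * x * antipode a3))).
rewrite mulr1 => <-; last by lin.
by apply: eq_sweedler => b2 b3; rewrite !mulrA.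
Qed.

Lemma comul_antipode_sw (U : lmodType k) (f : H -> H -> U) h : bilin f ->
  \sw_(x ⊗ y <- comul (antipode h)) f x y =
  \sw_(a ⊗ b <- comul h) f (antipode b) (antipode a).
Proof.
move=> bf; have [fl fr] := bf.
(* Both sides equal f applied to S(h_1)_1 h_2 S(h_5) ⊗ S(h_1)_2 h_3 S(h_4). *)
pose E := \sw_(h1 ⊗ h' <- comul h) \sw_(p ⊗ q <- comul h')
  \sw_(x ⊗ y <- comul (antipode h1)) \sw_(h2 ⊗ h3 <- comul p) \sw_(h4 ⊗ h5 <- comul q)
  f (x * (h2 * antipode h5)) (y * (h3 * antipode h4)).
transitivity E; last first.
  rewrite /E -comulA_sw; try lin.
  etransitivity; last first.
    by apply: (counitl_sw (f := fun x => \sw_(a ⊗ b <- comul x) f (antipode b) (antipode a))); lin.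
  apply: eq_sweedler => p q.
  transitivity (\sw_(h1 ⊗ h2' <- comul p) \sw_(x ⊗ y <- comul (antipode h1 * h2'))
    \sw_(h4 ⊗ h5 <- comul q) f (x * antipode h5) (y * antipode h4)).
    apply: eq_sweedler => h1 h2'; rewrite comulM_sw; last by lin.
    by do 3![apply: eq_sweedler => ? ?]; rewrite !mulrA.
  rewrite (antipodel_sw p (L := fun z => \sw_(x ⊗ y <- comul z)
    \sw_(h4 ⊗ h5 <- comul q) f (x * antipode h5) (y * antipode h4))); last by lin.
  rewrite comul1_sw; last by lin.
  by congr (_ *: _); apply: eq_sweedler => a b; rewrite !mul1r.
rewrite /E; symmetry.
etransitivity; last by apply: (counitr_sw (f := fun u => \sw_(x ⊗ y <- comul (antipode u)) f x y)); lin.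
apply: eq_sweedler => h1 h'.
rewrite exchange_sweedler linear_sweedler; last by lin.
apply: eq_sweedler => x y.
(* Splitting off h_2 allows h_3 and h_4 to be regrouped: h_3 S(h_4) contracts in the second
   argument, after which h_2 S(h_5) contracts in the first. *)
rewrite comulA_sw; try lin.
have := antipoder_sw h' (L := fun z => f (x * z) y).
rewrite mulr1 => <-; last by lin.
apply: eq_sweedler => h2 r.
rewrite -comulA_sw; try lin.
etransitivity; last by apply: (counitl_sw (f := fun z => f (x * (h2 * antipode z)) y)); lin.
apply: eq_sweedler => p h5.
have := antipoder_sw p (L := fun z => f (x * (h2 * antipode h5)) (y * z)).
by rewrite mulr1 => <-; last by lin.
Qed.

End Antipode.

(* The properties of the antipode that do not distinguish it from its inverse. *)
Record hopfAntiAut (k : fieldType) (H : hopfAlgebra k) := HopfAntiAut {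
  hanti :> {linear H -> H};
  hanti_inv : {linear H -> H};
  hantiK : cancel hanti hanti_inv;
  hantiVK : cancel hanti_inv hanti;
  hanti1 : hanti 1 = 1;
  hantiM : forall g h, hanti (g * h) = hanti h * hanti g;
  hanti_comul : forall h, comul (hanti h) = \sw_(a ⊗ b <- comul h) (hanti b ⊗ hanti a);
  hanti_counit : forall h, counit (hanti h) = counit h;
  hanti_haut : forall (f : hopfAut H) h, hanti (f h) = f (hanti h)
}.

(** * Anti-automorphisms of a Hopf algebra, closed under inversion *)

Section AntiAut.
Variables (k : fieldType) (H : hopfAlgebra k).

Lemma comul_hanti_sw (s : hopfAntiAut H) (U : lmodType k) (f : H -> H -> U) h : bilin f ->
  \sw_(a ⊗ b <- comul (s h)) f a b = \sw_(a ⊗ b <- comul h) f (s b) (s a).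
Proof. by move=> bf; rewrite hanti_comul; sw_norm. Qed.

Section Inverse.
Variable s : hopfAntiAut H.
Let sI := can_inj (hantiK s).

Fact hanti_inv1 : hanti_inv s 1 = 1.
Proof. by apply: sI; rewrite hantiVK hanti1. Qed.
Fact hanti_invM g h : hanti_inv s (g * h) = hanti_inv s h * hanti_inv s g.
Proof. by apply: sI; rewrite hantiM !hantiVK. Qed.
Fact hanti_inv_comul h :
  comul (hanti_inv s h) = \sw_(a ⊗ b <- comul h) (hanti_inv s b ⊗ hanti_inv s a).
Proof.
rewrite -{2}[h](hantiVK s) comul_hanti_sw; last by lin.
by rewrite [LHS]pure_spans; apply: eq_sweedler => a b; rewrite !hantiK.
Qed.
Fact hanti_inv_counit h : counit (hanti_inv s h) = counit h.
Proof. by rewrite -{2}[h](hantiVK s) hanti_counit. Qed.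
Fact hanti_inv_haut (f : hopfAut H) h : hanti_inv s (f h) = f (hanti_inv s h).
Proof. by apply: sI; rewrite hanti_haut !hantiVK. Qed.

Definition hanti_V : hopfAntiAut H :=
  HopfAntiAut (hantiVK s) (hantiK s) hanti_inv1 hanti_invM hanti_inv_comul
    hanti_inv_counit hanti_inv_haut.
End Inverse.

Lemma hantiKV (s : hopfAntiAut H) : cancel s (hanti_V s). Proof. exact: hantiK. Qed.
Lemma hantiVKV (s : hopfAntiAut H) : cancel (hanti_V s) s. Proof. exact: hantiVK. Qed.
Lemma hanti_VV (s : hopfAntiAut H) : hanti_V (hanti_V s) =1 s. Proof. by []. Qed.

Lemma antipode_comul (h : H) :
  comul (antipode h) = \sw_(a ⊗ b <- comul h) (antipode b ⊗ antipode a).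
Proof. by rewrite [LHS]pure_spans comul_antipode_sw; last by lin. Qed.

Lemma antipode_hanti : bijective (@antipode k H) ->
  exists s : hopfAntiAut H, s =1 antipode.
Proof.
case=> t sK tK.
have lt : linear t by move=> a x y; apply: (can_inj sK); rewrite linearP !tK.
pose t' : {linear H -> H} := HB.pack t (GRing.isLinear.Build k H H *:%R t lt).
exists (@HopfAntiAut k H antipode t' sK tK (antipode1 H) (@antipodeM k H) antipode_comul
  (@counit_antipode k H) (@haut_antipode k H)).
by [].
Qed.

End AntiAut.

(** * The crossed category *)

Section Equality.
Variables (k : fieldType) (H1 H2 : hopfAlgebra k).
Local Notation LR := (lrModule H1 H2).

(* [space_cast erefl] reduces to [id]: an equality between objects with convertible
   spaces amounts to the identity being a morphism. *)
Definition space_cast (V W : lmodType k) (e : V = W) : V -> W :=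
  let: erefl := e in id.

Lemma lr_ext (M N : LR) (e : lr_space M = lr_space N) :
  lr_hom_axioms (space_cast e) -> M = N.
Proof.
case: M N e => [V g la ra lc rc L] [W g' la' ra' lc' rc' L'] /= e.
case: W / e la' ra' lc' rc' L' => la' ra' lc' rc' L' [/= gg _ El Er Elc Erc].
have Ela : la = la' by apply/funext => h; apply/funext => m; exact: El.
have Era : ra = ra' by apply/funext => m; apply/funext => h; exact: Er.
have Elc' : lc = lc' by apply/funext => m; rewrite Elc -pure_spans.
have Erc' : rc = rc' by apply/funext => m; rewrite Erc -pure_spans.
by case: _ / gg Ela Era Elc' Erc' L' => <- <- <- <- L'; congr LRModule; exact: Prop_irrelevance.
Qed.

Lemma lrfd_ext (M N : lrfdModule H1 H2) (e : lr_space M = lr_space N) :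
  lr_hom_axioms (space_cast e) -> M = N.
Proof.
case: M N e => [M fM] [N fN] /= e /lr_ext MN; case: N / MN fN {e} => fN.
by congr LRfdModule; exact: Prop_irrelevance.
Qed.

(** The equalities of spaces are kept apart from those of objects. When the spaces are convertible
    they can be [erefl], so that no cast remains in the last condition, although the objects are
    equal only propositionally. Once the objects are identified, proof irrelevance makes both casts
    trivial. *)
Lemma lrfd_hom_eq (M N M' N' : LRfd H1 H2) (f : lr_hom M N) (f' : lr_hom M' N')
    (eM : lr_space M = lr_space M') (eN : lr_space N = lr_space N') :
    M = M' -> N = N' -> (forall m, space_cast eN (f m) = f' (space_cast eM m)) ->
  hom_eq (C := LRfd H1 H2) f f'.
Proof.
move=> MM NN; case: M' / MM f' eM => f' eM; case: N' / NN f' eN => f' eN.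
rewrite (Prop_irrelevance eM erefl) (Prop_irrelevance eN erefl) => /lr_homP ff'.
have -> : f = f' by exact: ff'.
exact: hom_eq_refl.
Qed.
End Equality.

Section IndexComponents.
Variables (k : fieldType) (H1 H2 : hopfAlgebra k).
Local Notation G := (lr_index H1 H2).
Local Open Scope group_scope.
Implicit Types a b : G.
Fact ix_alphaM a b : ix_alpha (a * b)%g = (ix_alpha b * ix_alpha a)%g. Proof. by []. Qed.
Fact ix_betaM a b :
  ix_beta (a * b)%g = (ix_alpha b * ix_beta a * (ix_alpha b)^-1 * ix_beta b)%g.
Proof. by []. Qed.
Fact ix_gammaM a b : ix_gamma (a * b)%g = (ix_gamma a * ix_gamma b)%g. Proof. by []. Qed.
Fact ix_deltaM a b :
  ix_delta (a * b)%g = (ix_delta b * (ix_gamma b)^-1 * ix_delta a * ix_gamma b)%g.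
Proof. by []. Qed.
Fact ix_alphaV a : ix_alpha a^-1 = (ix_alpha a)^-1%g. Proof. by []. Qed.
Fact ix_betaV a : ix_beta a^-1 = ((ix_alpha a)^-1 * (ix_beta a)^-1 * ix_alpha a)%g.
Proof. by []. Qed.
Fact ix_gammaV a : ix_gamma a^-1 = (ix_gamma a)^-1%g. Proof. by []. Qed.
Fact ix_deltaV a : ix_delta a^-1 = (ix_gamma a * (ix_delta a)^-1 * (ix_gamma a)^-1)%g.
Proof. by []. Qed.
Fact ix_alpha1 : ix_alpha (1 : G)%g = 1%g. Proof. by []. Qed.
Fact ix_beta1 : ix_beta (1 : G)%g = 1%g. Proof. by []. Qed.
Fact ix_gamma1 : ix_gamma (1 : G)%g = 1%g. Proof. by []. Qed.
Fact ix_delta1 : ix_delta (1 : G)%g = 1%g. Proof. by []. Qed.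
(** The group operations on indices hide the components from [rewrite]; these equations, true by
    computation, expose them. *)
Definition ixE := (ix_alphaM, ix_betaM, ix_gammaM, ix_deltaM,
  ix_alphaV, ix_betaV, ix_gammaV, ix_deltaV, ix_alpha1, ix_beta1, ix_gamma1, ix_delta1).
End IndexComponents.

Definition groupE :=
  (@mulgA, @invgM, @invgK, @invg1, @mulgK, @mulgVK, @mulgV, @mulVg, @mulg1, @mul1g).

Ltac lr_proj :=
  cbn [lact ract lcoact rcoact lr_deg lr_space lr_tens lr_unit lr_conj lrfd_val lrfd_conj
    lrfd_tens lrfd_unit space_cast].
Ltac lr_unfold :=
  do 3![lr_proj; unfold tens_lact, tens_ract, tens_lcoact, tens_rcoact,
    conj_lact, conj_ract, conj_lcoact, conj_rcoact,
    unit_lact, unit_ract, unit_lcoact, unit_rcoact]; lr_proj.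
(** Automorphisms applied one after the other are merged into a single group element, which is then
    normalised. *)
Ltac haut_eq := rewrite -?hautMul ?ixE ?groupE.

(** Conjugation leaves spaces alone, so reflexivity can serve as the equality of spaces. *)
Ltac same_space :=
  lazymatch goal with
  | |- ?M = ?N => apply: (@lrfd_ext _ _ _ M N (erefl (lr_space (lrfd_val M))))
  end.

Ltac same_fun :=
  lazymatch goal with
  | |- @hom_eq _ _ ?M ?N ?f ?M' ?N' ?f' =>
    apply: (@lrfd_hom_eq _ _ _ M N M' N' f f' (erefl (lr_space (lrfd_val M)))
      (erefl (lr_space (lrfd_val N))))
  end.

Section Category.
Variables (k : fieldType) (H1 H2 : hopfAlgebra k).
Local Notation C := (LRfd H1 H2).
Local Notation G := (lr_index H1 H2).

Lemma tens_map_id (U V : lmodType k) (t : (U ⊗ V)%type) : tens_map id id t = t.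
Proof. by rewrite [RHS]pure_spans. Qed.

Lemma lrfd_category : is_category C.
Proof. by split=> *; apply: lr_homP. Qed.

Ltac tens_ext4 m n p q :=
  let t := fresh in intro t; move: t;
  apply: tens_lin_ext3l; [lin|lin|intro t; move=> p q; move: t;
    apply: tens_lin_ext; [lin|lin|move=> m n]].

Lemma lrfd_monoidal : is_monoidal C.
Proof.
split.
- by move=> X Y; apply: lr_homP => t; exact: tens_map_id.
- move=> X Y Z X' Y' Z' f g f' g'; apply: lr_homP; rewrite /= /tens_map.
  by tens_ext m n; sw_norm.
- move=> X Y Z; split; apply: lr_homP; [exact: tens_assocK|exact: tens_assoc_invK].
- move=> X Y Z X' Y' Z' f g h; apply: lr_homP; rewrite /= /tens_assoc /tens_map.
  by move=> t; move: t; apply: tens_lin_ext3l; [lin|lin|move=> m n p]; sw_norm.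
- move=> X; split; apply: lr_homP; [exact: tens_lunitK|exact: tens_lunit_invK].
- move=> X Y f; apply: lr_homP; rewrite /= /tens_lunit /tens_map.
  tens_ext a m; sw_norm; by rewrite (linear_scale _ _ (lr_hom_lin f)).
- move=> X; split; apply: lr_homP; [exact: tens_runitK|exact: tens_runit_invK].
- move=> X Y f; apply: lr_homP; rewrite /= /tens_runit /tens_map.
  tens_ext m a; sw_norm; by rewrite (linear_scale _ _ (lr_hom_lin f)).
- move=> W X Y Z; apply: lr_homP; rewrite /= /tens_assoc /tens_map.
  by tens_ext4 m n p q; sw_norm.
- move=> X Y; apply: lr_homP; rewrite /= /tens_assoc /tens_map /tens_lunit /tens_runit.
  move=> t; move: t; apply: tens_lin_ext3l; [lin|lin|move=> m a n]; sw_norm.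
  by rewrite (linear_scale _ _ (pure_linl _)) (linear_scale _ _ (pure_linr _)).
Qed.

Lemma lrfd_graded : is_graded C.
Proof. by split=> // X Y [f []]. Qed.

Lemma lrfd_conj_tens (a : G) (X Y : lrfdModule H1 H2) :
  lrfd_conj a (lrfd_tens X Y) = lrfd_tens (lrfd_conj a X) (lrfd_conj a Y).
Proof.
same_space; split; lr_unfold.
- by rewrite !groupE.
- by lin.
- by move=> h; tens_ext m n; sw_norm.
- move=> h; tens_ext m n; sw_norm.
  by apply: eq_sweedler => x y; haut_eq.
- tens_ext m n; sw_norm.
  apply: eq_sweedler => x m0; apply: eq_sweedler => y n0.
  by rewrite hautM; haut_eq.
- tens_ext m n; sw_norm.
  by apply: eq_sweedler => m0 x; apply: eq_sweedler => n0 y; rewrite hautM.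
Qed.

Lemma lrfd_conj_one (a : G) : lrfd_conj a (lrfd_unit H1 H2) = lrfd_unit H1 H2.
Proof.
same_space; split; lr_unfold.
- by rewrite !groupE.
- by lin.
- by move=> h m; rewrite haut_counit.
- by move=> h m; rewrite haut_counit.
- by move=> m; sw_norm; rewrite haut1.
- by move=> m; sw_norm; rewrite haut1.
Qed.

Lemma lrfd_conjM (a b : G) (X : lrfdModule H1 H2) :
  lrfd_conj (a * b)%g X = lrfd_conj a (lrfd_conj b X).
Proof.
same_space; split; lr_unfold.
- by rewrite !groupE.
- by lin.
- by move=> h m; haut_eq.
- by move=> h m; haut_eq.
- by move=> m; sw_norm; apply: eq_sweedler => x m0; haut_eq.
- by move=> m; sw_norm; apply: eq_sweedler => m0 x; haut_eq.
Qed.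

Lemma lrfd_conj1 (X : lrfdModule H1 H2) : lrfd_conj 1%g X = X.
Proof.
same_space; split; lr_unfold.
- by rewrite !groupE.
- by lin.
- by move=> h m; haut_eq.
- by move=> h m; haut_eq.
- move=> m; sw_norm; rewrite [LHS]pure_spans; apply: eq_sweedler => x m0; haut_eq.
  by [].
- move=> m; sw_norm; rewrite [LHS]pure_spans; apply: eq_sweedler => x m0; haut_eq.
  by [].
Qed.

(** As [lr_conj_hom] keeps the underlying map, the equations between morphisms hold by computation;
    what [same_fun] leaves open is that sources and targets agree. *)
Lemma lrfd_conjugation : is_conjugation C.
Proof.
split.
- by move=> a X; apply: lr_homP.
- by move=> a X Y Z f g; apply: lr_homP.
- exact: lrfd_conj_tens.
- move=> a X Y X' Y' f g.
  by same_fun => //; exact: lrfd_conj_tens.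
- exact: lrfd_conj_one.
- move=> a X Y Z; same_fun => //=.
    by rewrite !lrfd_conj_tens.
  by rewrite !lrfd_conj_tens.
- move=> a X; same_fun => //=.
  by rewrite !lrfd_conj_tens lrfd_conj_one.
- move=> a X; same_fun => //=.
  by rewrite !lrfd_conj_tens lrfd_conj_one.
- exact: lrfd_conjM.
- move=> a b X Y f; same_fun => //=; exact: lrfd_conjM.
- exact: lrfd_conj1.
- move=> X Y f; same_fun => //=; exact: lrfd_conj1.
- move=> a b X; split=> [dX|[Y dY ->]]; last by rewrite -dY.
  (* An object of degree [b * a * b^-1] is the conjugate by [b] of its own conjugate by [b^-1]. *)
  exists (lrfd_conj b^-1%g X); last by rewrite -[RHS]lrfd_conjM mulgV -[LHS]lrfd_conj1.
  rewrite /= in dX *; by rewrite dX !groupE.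
Qed.

Lemma lrfd_crossed : is_crossed_tcategory C.
Proof.
split; [exact: lrfd_category|exact: lrfd_monoidal|exact: lrfd_graded|exact: lrfd_conjugation].
Qed.

End Category.

(** * The braiding *)

Ltac step tac := etransitivity; [tac | cbn beta].

Section AntipodeInverse.
Variables (k : fieldType) (H : hopfAlgebra k) (s : hopfAntiAut H).
Hypothesis sE : s =1 antipode.
Local Notation t := (hanti_V s).

(** Applying the antimultiplicative [t] to [a * antipode b] gives [b * t a], which is why the two
    tensor factors of the comultiplication appear in reverse order. *)
Lemma hanti_invr_sw (U : lmodType k) (L : H -> U) h : linear L ->
  \sw_(a ⊗ b <- comul h) L (b * t a) = counit h *: L 1.
Proof.
move=> lL; have := antipoder_sw h (L := fun x => L (t x)).
rewrite (hanti1 (hanti_V s)) => <-; last by lin.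
by apply: eq_sweedler => a b; rewrite -sE hantiM hantiKV.
Qed.

Lemma hanti_invl_sw (U : lmodType k) (L : H -> U) h : linear L ->
  \sw_(a ⊗ b <- comul h) L (t b * a) = counit h *: L 1.
Proof.
move=> lL; have := antipodel_sw h (L := fun x => L (t x)).
rewrite (hanti1 (hanti_V s)) => <-; last by lin.
by apply: eq_sweedler => a b; rewrite -sE hantiM hantiKV.
Qed.
End AntipodeInverse.

Section Braiding.
Variables (k : fieldType) (H1 H2 : hopfAlgebra k).
Local Notation C := (LRfd H1 H2).
Local Notation LR := (lrModule H1 H2).
Local Notation α := ix_alpha.
Local Notation β := ix_beta.
Local Notation γ := ix_gamma.
Local Notation δ := ix_delta.

Definition braid (M N : LR) (t : M ⊗ N) : N ⊗ M :=
  \sw_(m ⊗ n <- t) \sw_(x ⊗ m0 <- lcoact m) \sw_(n0 ⊗ y <- rcoact n)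
    (lact ((β (lr_deg M))^-1%g x) n0 ⊗ ract m0 ((δ (lr_deg M))^-1%g y)).

(** Each condition comes from one compatibility law: left linearity from the left law of [M], right
    linearity from the right law of [N], left colinearity from the left law of [N] at [b' x], and
    right colinearity from the right law of [M] at [d' y]. In the colinear cases coassociativity
    first splits the coefficient [x] or [y]. *)
Lemma braid_axioms (M N : LR) :
  lr_hom_axioms (M := lr_tens M N) (N := lr_tens (lr_conj (lr_deg M) N) M) (@braid M N).
Proof.
set b' := ((β (lr_deg M))^-1%g); set d' := ((δ (lr_deg M))^-1%g).
split; unfold braid; lr_unfold; rewrite -/b' -/d'.
- by rewrite mulgVK.
- by lin.
- move=> h; tens_ext m n; sw_norm.
  have E := lact_lcoact_sw h m (f := fun x m0 =>
    \sw_(n0 ⊗ y <- rcoact n) (lact (b' x) n0 ⊗ ract m0 (d' y))).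
  etransitivity; [etransitivity; [|symmetry; apply: E; lin]|];
    do 3![apply: eq_sweedler => ? ?].
    by rewrite hautM hautKV (lr_lactM (lr_laws _)).
  by rewrite hautM (lr_lactM (lr_laws _)) -(lr_bimod (lr_laws _)).
- move=> h; tens_ext m n; sw_norm.
  (* [q] is the twist through which [H2] acts on the factor [N] of the source. *)
  set q := (_ * γ (lr_deg N))%g.
  have E := ract_rcoact_sw (q h) n (f := fun n0 y =>
    \sw_(x ⊗ m0 <- lcoact m) (lact (b' x) n0 ⊗ ract m0 (d' y))).
  etransitivity; [etransitivity; [|symmetry; apply: E; lin]|]; [symmetry|];
    (step ltac:(apply: comul_haut_sw; lin)); apply: eq_sweedler => h1 h2;
    rewrite exchange_sweedler; do 2![apply: eq_sweedler => ? ?].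
    by rewrite hautM (lr_ractM (lr_laws _)); haut_eq.
  by rewrite hautM (lr_ractM (lr_laws _)) (lr_bimod (lr_laws _)) /q /d'; haut_eq.
- tens_ext m n; sw_norm.
  set q2 := (_ * β (lr_deg M) / α (lr_deg N))%g.
  set q' := (_ / α (lr_deg M))%g; set q := (_ / α (lr_deg N))%g.
  (* Of the two coefficients that coassociativity yields for [m], one acts on [n] and the other
     stays in [H1]. Both sides thus take the shape of the left law of [N]. *)
  transitivity (\sw_(x ⊗ m0 <- lcoact m) \sw_(x1 ⊗ x2 <- comul x)
    \sw_(n0 ⊗ y <- rcoact n) \sw_(z ⊗ n00 <- lcoact (lact (b' x1) n0))
     ((α (lr_deg M) (q z) * q' x2) ⊗ (n00 ⊗ ract m0 (d' y)))).
    rewrite lcoactA_sw; try lin; apply: eq_sweedler => x m0.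
    rewrite [RHS]exchange_sweedler; apply: eq_sweedler => n0 y.
    by rewrite exchange_sweedler.
  transitivity (\sw_(x ⊗ m0 <- lcoact m) \sw_(x1 ⊗ x2 <- comul x)
    \sw_(n0 ⊗ y <- rcoact n) \sw_(z ⊗ n00 <- lcoact n0)
     ((α (lr_deg N) x1 * q2 z) ⊗ (lact (b' x2) n00 ⊗ ract m0 (d' y)))); last first.
    rewrite lcoactA_sw; try lin; apply: eq_sweedler => x m0.
    rewrite [RHS]exchange_sweedler; apply: eq_sweedler => x' m00.
    by symmetry; apply: bicomod_sw; lin.
  apply: eq_sweedler => x m0.
  rewrite exchange_sweedler [RHS]exchange_sweedler; apply: eq_sweedler => n0 y.
  have E := lact_lcoact_sw (b' x) n0 (f := fun z n00 =>
    (α (lr_deg M) (q z) ⊗ (n00 ⊗ ract m0 (d' y)))).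
  etransitivity; [etransitivity; [|symmetry; apply: E; lin]|]; [symmetry|];
    (step ltac:(apply: comul_haut_sw; lin)); do 2![apply: eq_sweedler => ? ?].
    by rewrite !hautM /q /q' /b'; haut_eq.
  by rewrite !hautM /q /q2 /b'; haut_eq.
- tens_ext m n; sw_norm.
  transitivity (\sw_(x ⊗ m0 <- lcoact m) \sw_(n0 ⊗ y <- rcoact n) \sw_(y1 ⊗ y2 <- comul y)
    \sw_(m00 ⊗ z <- rcoact (ract m0 (d' y2)))
     ((lact (b' x) n0 ⊗ m00) ⊗ (γ (lr_deg M) (d' y1) * z))).
    apply: eq_sweedler => x m0.
    by rewrite -rcoactA_sw; try lin.
  transitivity (\sw_(x ⊗ m0 <- lcoact m) \sw_(n0 ⊗ y <- rcoact n) \sw_(y1 ⊗ y2 <- comul y)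
    \sw_(m00 ⊗ z <- rcoact m0)
     ((lact (b' x) n0 ⊗ ract m00 (d' y1)) ⊗ (z * y2))); last first.
    symmetry; transitivity (\sw_(m0 ⊗ z <- rcoact m) \sw_(x ⊗ m00 <- lcoact m0)
      \sw_(n0 ⊗ y <- rcoact n) \sw_(y1 ⊗ y2 <- comul y)
     ((lact (b' x) n0 ⊗ ract m00 (d' y1)) ⊗ (z * y2))).
      apply: eq_sweedler => m0 z; rewrite exchange_sweedler.
      by apply: eq_sweedler => x m00; apply: rcoactA_sw; lin.
    rewrite -bicomod_sw; try lin; apply: eq_sweedler => x m0.
    rewrite exchange_sweedler; apply: eq_sweedler => n0 y.
    by rewrite exchange_sweedler.
  apply: eq_sweedler => x m0; apply: eq_sweedler => n0 y.
  have E := ract_rcoact_sw (d' y) m0 (f := fun m00 z => (lact (b' x) n0 ⊗ m00) ⊗ z).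
  etransitivity; [etransitivity; [|symmetry; apply: E; lin]|]; [symmetry|];
    (step ltac:(apply: comul_haut_sw; lin)); do 2![apply: eq_sweedler => ? ?] => //.
  by rewrite hautVKV.
Qed.
Definition lr_braid (M N : LR) : lr_hom (lr_tens M N) (lr_tens (lr_conj (lr_deg M) N) M) :=
  LRHom (braid_axioms M N).

Section Inverse.
Variables (s1 : hopfAntiAut H1) (s2 : hopfAntiAut H2).
Hypotheses (s1E : s1 =1 antipode) (s2E : s2 =1 antipode).
Local Notation t1 := (hanti_V s1).
Local Notation t2 := (hanti_V s2).

Definition braid_inv (M N : LR) (t : N ⊗ M) : M ⊗ N :=
  \sw_(n ⊗ m <- t) \sw_(x ⊗ m0 <- lcoact m) \sw_(n0 ⊗ y <- rcoact n)
    (ract m0 (t2 ((δ (lr_deg M))^-1%g y)) ⊗ lact (t1 ((β (lr_deg M))^-1%g x)) n0).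

(** The left coaction ignores the right action and the right coaction ignores the left action, so
    the second map coacts again on the parts m_(0) and n_[0]. By coassociativity the coefficients
    combine into [t1 x2 * x1] and [y2 * t2 y1], which contract to counits. *)
Lemma braidK (M N : LR) : cancel (@braid M N) (@braid_inv M N).
Proof.
rewrite /cancel /braid /braid_inv.
set b' := ((β (lr_deg M))^-1%g); set d' := ((δ (lr_deg M))^-1%g).
tens_ext m n; sw_norm.
transitivity (\sw_(x ⊗ m0 <- lcoact m) \sw_(x1 ⊗ x2 <- comul x)
  \sw_(n0 ⊗ y <- rcoact n) \sw_(y1 ⊗ y2 <- comul y)
  (ract m0 (d' (y2 * t2 y1)) ⊗ lact (b' (t1 x2 * x1)) n0)).
  rewrite lcoactA_sw; try lin; apply: eq_sweedler => x m0.
  rewrite [LHS]exchange_sweedler; apply: eq_sweedler => x' m00.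
  rewrite -rcoactA_sw; try lin; do 2![apply: eq_sweedler => ? ?].
  by rewrite -(lr_lactM (lr_laws _)) -(lr_ractM (lr_laws _)) !hautM !hanti_haut.
transitivity (\sw_(x ⊗ m0 <- lcoact m) counit x *: (m0 ⊗ n)).
  apply: eq_sweedler => x m0.
  have := hanti_invl_sw s1E x (L := fun z => \sw_(n0 ⊗ y <- rcoact n)
    \sw_(y1 ⊗ y2 <- comul y) (ract m0 (d' (y2 * t2 y1)) ⊗ lact (b' z) n0)).
  move=> ->; last by lin.
  congr (_ *: _).
  rewrite -(rcoact_counit_sw (f := fun n0 => m0 ⊗ n0) n); last by lin.
  apply: eq_sweedler => n0 y; rewrite haut1 (lr_lact1 (lr_laws _)).
  rewrite (hanti_invr_sw s2E y (L := fun z => ract m0 (d' z) ⊗ n0)); last by lin.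
  by rewrite haut1 (lr_ract1 (lr_laws _)).
by apply: (lcoact_counit_sw (f := fun m0 => m0 ⊗ n)); lin.
Qed.

Lemma braid_invK (M N : LR) : cancel (@braid_inv M N) (@braid M N).
Proof.
rewrite /cancel /braid /braid_inv.
set b' := ((β (lr_deg M))^-1%g); set d' := ((δ (lr_deg M))^-1%g).
tens_ext n m; sw_norm.
transitivity (\sw_(x ⊗ m0 <- lcoact m) \sw_(x1 ⊗ x2 <- comul x)
  \sw_(n0 ⊗ y <- rcoact n) \sw_(y1 ⊗ y2 <- comul y)
  (lact (b' (x2 * t1 x1)) n0 ⊗ ract m0 (d' (t2 y2 * y1)))).
  rewrite lcoactA_sw; try lin; apply: eq_sweedler => x m0.
  rewrite [LHS]exchange_sweedler; apply: eq_sweedler => x' m00.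
  rewrite -rcoactA_sw; try lin; do 2![apply: eq_sweedler => ? ?].
  by rewrite -(lr_lactM (lr_laws _)) -(lr_ractM (lr_laws _)) !hautM !hanti_haut.
transitivity (\sw_(x ⊗ m0 <- lcoact m) counit x *: (n ⊗ m0)).
  apply: eq_sweedler => x m0.
  have := hanti_invr_sw s1E x (L := fun z => \sw_(n0 ⊗ y <- rcoact n)
    \sw_(y1 ⊗ y2 <- comul y) (lact (b' z) n0 ⊗ ract m0 (d' (t2 y2 * y1)))).
  move=> ->; last by lin.
  congr (_ *: _).
  rewrite -(rcoact_counit_sw (f := fun n0 => n0 ⊗ m0) n); last by lin.
  apply: eq_sweedler => n0 y; rewrite haut1 (lr_lact1 (lr_laws _)).
  rewrite (hanti_invl_sw s2E y (L := fun z => n0 ⊗ ract m0 (d' z))); last by lin.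
  by rewrite haut1 (lr_ract1 (lr_laws _)).
by apply: (lcoact_counit_sw (f := fun m0 => n ⊗ m0)); lin.
Qed.

Lemma braid_inv_lin (M N : LR) : linear (@braid_inv M N).
Proof. by rewrite /braid_inv; lin. Qed.
End Inverse.

Lemma lrfd_braiding : bijective (@antipode k H1) -> bijective (@antipode k H2) ->
  is_braiding (C := C) (fun M N => lr_braid M N).
Proof.
move=> /antipode_hanti[s1 s1E] /antipode_hanti[s2 s2E].
split.
- move=> M N.
  exists (LRHom (lr_inv_axioms (braid_axioms M N) (@braid_inv_lin s1 s2 M N)
    (@braidK _ _ s1E s2E M N) (@braid_invK _ _ s1E s2E M N))).
  by split; apply: lr_homP => t /=; rewrite ?braidK ?braid_invK.
- move=> X Y X' Y' f g.
  (* The two targets are conjugates by the degrees of [X] and [X'], which agree by [Fd]. *)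
  have [Fd _ Fl Fr _ _] := lr_fun_axioms f; have [_ _ Gl Gr _ _] := lr_fun_axioms g.
  same_fun => //=; first by rewrite Fd.
  rewrite /tens_map /braid; tens_ext m n; sw_norm.
  do 2![apply: eq_sweedler => ? ?]; by rewrite Fd Gl Fr.
- move=> X Y Z; same_fun => //=; first by rewrite lrfd_conjM.
  rewrite /tens_map /tens_assoc /tens_assoc_inv /braid; lr_unfold.
  move=> t; move: t; apply: tens_lin_ext3l; [lin|lin|move=> m n p].
  sw_norm; rewrite [LHS]exchange_sweedler; apply: eq_sweedler => y n0.
  rewrite [LHS]exchange_sweedler.
  (* Coassociativity of the right coaction on [p] distributes its coefficient over [m] and [n]. *)
  transitivity (\sw_(p0 ⊗ u <- rcoact p) \sw_(p00 ⊗ v <- rcoact p0) \sw_(x ⊗ m0 <- lcoact m)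
    (lact ((β (lr_deg X * lr_deg Y))^-1%g
        (α (lr_deg Y) x * (α (lr_deg Y) * β (lr_deg X) / α (lr_deg Y))%g y)) p00 ⊗
     (ract m0 (γ (lr_deg Y) ((δ (lr_deg X * lr_deg Y))^-1%g v)) ⊗
      ract n0 (((γ (lr_deg Y))^-1 * δ (lr_deg X) * γ (lr_deg Y))%g
        ((δ (lr_deg X * lr_deg Y))^-1%g u))))).
    rewrite rcoactA_sw; try lin; apply: eq_sweedler => ? ?.
    by rewrite [LHS]exchange_sweedler.
  apply: eq_sweedler => p0 u; rewrite [LHS]exchange_sweedler.
  do 2![apply: eq_sweedler => ? ?].
  by rewrite hautM -(lr_lactM (lr_laws _)); haut_eq.
- move=> X Y Z; same_fun => //=; first by rewrite lrfd_conj_tens.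
  rewrite /tens_map /tens_assoc /tens_assoc_inv /braid; lr_unfold.
  move=> t; move: t; apply: tens_lin_ext3r; [lin|lin|move=> m n p].
  sw_norm.
  (* Here the left coefficient of [m] is distributed over [n] and [p]. *)
  transitivity (\sw_(x ⊗ m0 <- lcoact m) \sw_(x1 ⊗ x2 <- comul x)
    \sw_(n0 ⊗ u <- rcoact n) \sw_(p0 ⊗ v <- rcoact p)
    (lact ((β (lr_deg X))^-1%g x1) n0 ⊗ lact ((β (lr_deg X))^-1%g x2) p0 ⊗
     ract m0 ((δ (lr_deg X))^-1%g (u * v)))).
    apply: eq_sweedler => x m0; rewrite [RHS]exchange_sweedler; apply: eq_sweedler => n0 u.
    by rewrite exchange_sweedler.
  rewrite lcoactA_sw; try lin.
  apply: eq_sweedler => x m0; rewrite [LHS]exchange_sweedler.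
  do 3![apply: eq_sweedler => ? ?].
  by rewrite hautM (lr_ractM (lr_laws _)).
- move=> a X Y; same_fun => /=; first exact: lrfd_conj_tens.
    transitivity (lrfd_tens (lrfd_conj a (lrfd_conj (lr_deg X) Y)) (lrfd_conj a X)).
      exact: lrfd_conj_tens.
    by congr lrfd_tens; rewrite -!lrfd_conjM mulgVK.
  rewrite /braid; lr_unfold.
  tens_ext m n; sw_norm.
  by do 2![apply: eq_sweedler => ? ?]; haut_eq.
Qed.
End Braiding.

(** * Duality *)

(* Pairings take values in [k^o], so that [lin] can prove them linear, but scaling by
   an element of [k^o] confuses it; [kscale] hides this. *)
Definition kscale (k : fieldType) (U : lmodType k) (c : k^o) (u : U) : U := (c : k) *: u.
Notation "c •: u" := (kscale c u) (at level 40) : ring_scope.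

Lemma kscale_linl (k : fieldType) (U : lmodType k) (u : U) : linear (fun c => c •: u).
Proof. exact: regular_linl. Qed.
Lemma kscale_linr (k : fieldType) (U : lmodType k) (c : k^o) : linear (fun u : U => c •: u).
Proof. exact: scale_linr. Qed.
Lemma kscale_sweedler (k : fieldType) (V W U : lmodType k) (t : V ⊗ W) (F : V -> W -> U) (c : k^o) :
  c •: (\sw_(v ⊗ w <- t) F v w) = \sw_(v ⊗ w <- t) (c •: F v w).
Proof. exact: (linear_sweedler t F (@kscale_linr k U c)). Qed.

(** * Perfect pairings and their dual basis tensors *)

Section Pairing.
Variable k : fieldType.

(* [lin] finds these in the context. *)
Let ksl := @kscale_linl k.
Let ksr := @kscale_linr k.

(** A perfect pairing together with its dual basis tensor [t0]. The last two fields are the zigzag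
    identities; their symmetry in [X] and [Y] allows the pairing to be read in both directions. *)
Record pairing (X Y : lmodType k) (b : Y -> X -> k^o) (t0 : X ⊗ Y) : Prop := {
  pairing_linl : forall x, linear (fun y => b y x);
  pairing_linr : forall y, linear (fun x => b y x);
  pairing_coevl : forall x, \sw_(x' ⊗ y <- t0) (b y x •: x') = x;
  pairing_coevr : forall y, \sw_(x ⊗ y' <- t0) (b y x •: y') = y
}.

(** Coordinates turn [V] into its own dual, through the dot product and the sum of the e_i ⊗ e_i.
    The dual object can therefore live on the same space, from which it inherits finite
    dimension. *)
Lemma fin_dim_pairing (V : lmodType k) : fin_dim V ->
  exists (b : V -> V -> k^o) (t0 : V ⊗ V), pairing b t0.
Proof.
move=> [n [[f lf [f' fK f'K]]]].
have lf' : linear f' by move=> a x y; apply: (can_inj fK); rewrite lf !f'K.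
pose b (x y : V) : k^o := (f x *m (f y)^T) 0 0.
pose t0 : (V ⊗ V)%type := \sum_(i < n) (f' (delta_mx 0 i) ⊗ f' (delta_mx 0 i)).
have bl x : linear (fun y => b y x).
  by move=> a y z; rewrite /b lf mulmxDl -scalemxAl !mxE.
have br y : linear (fun x => b y x).
  by move=> a x z; rewrite /b lf linearP mulmxDr -scalemxAr !mxE.
have bE x i : b x (f' (delta_mx 0 i)) = f x 0 i.
  by rewrite /b f'K trmx_delta -colE mxE.
have bC x y : b x y = b y x.
  by rewrite /b -[f x *m _]trmxK trmx_mul trmxK mxE.
clearbody b; exists b, t0; split=> // x; rewrite /t0.
  rewrite (lin_sum _ _ (sweedler_linear (f := fun x' y => b y x •: x') _)); last by lin.
  rewrite -[RHS]fK [f x in RHS]row_sum_delta (lin_sum _ _ lf'); apply: eq_bigr => i _.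
  by rewrite sweedler_pure; [rewrite bC bE (linear_scale _ _ lf')|lin].
rewrite (lin_sum _ _ (sweedler_linear (f := fun x' y' => b x x' •: y') _)); last by lin.
rewrite -[RHS]fK [f x in RHS]row_sum_delta (lin_sum _ _ lf'); apply: eq_bigr => i _.
by rewrite sweedler_pure; [rewrite bE (linear_scale _ _ lf')|lin].
Qed.

Section Theory.
Variables (X Y : lmodType k) (b : Y -> X -> k^o) (t0 : X ⊗ Y).
Hypothesis bP : pairing b t0.
Let bl := pairing_linl bP.
Let br := pairing_linr bP.

Lemma pairing_sweedlerl (V W : lmodType k) (t : V ⊗ W) (F : V -> W -> Y) x :
  b (\sw_(v ⊗ w <- t) F v w) x = \sw_(v ⊗ w <- t) (b (F v w) x).
Proof. exact: (linear_sweedler t F (bl x)). Qed.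

Lemma pairingZl c y x : b (c *: y) x = c * b y x.
Proof. exact: (linear_scale c y (bl x)). Qed.

Lemma pairing_coevl_sw (U : lmodType k) (f : X -> U) x : linear f ->
  \sw_(x' ⊗ y <- t0) b y x •: f x' = f x.
Proof.
move=> lf; rewrite -[in RHS](pairing_coevl bP x) (linear_sweedler _ _ lf).
by apply: eq_sweedler => x' y; rewrite (linear_scale _ _ lf).
Qed.

Lemma pairing_coevr_sw (U : lmodType k) (f : Y -> U) y : linear f ->
  \sw_(x ⊗ y' <- t0) b y x •: f y' = f y.
Proof.
move=> lf; rewrite -[in RHS](pairing_coevr bP y) (linear_sweedler _ _ lf).
by apply: eq_sweedler => x y'; rewrite (linear_scale _ _ lf).
Qed.

Lemma pairing_ext (y y' : Y) : (forall x, b y x = b y' x) -> y = y'.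
Proof.
move=> yy; rewrite -(pairing_coevr bP y) -(pairing_coevr bP y').
by apply: eq_sweedler => x z; rewrite yy.
Qed.

(** Inserting [t0] recovers a tensor from its contractions against [X]. The axioms of the dual
    object can thus be checked after pairing with an element of [M]. *)
Lemma pairing_ext_tensr (U : lmodType k) (t t' : U ⊗ Y) :
  (forall x, \sw_(u ⊗ y <- t) (b y x •: u) = \sw_(u ⊗ y <- t') (b y x •: u)) ->
  t = t'.
Proof.
move=> tt; have E (r : (U ⊗ Y)%type) :
    r = \sw_(x ⊗ z <- t0) ((\sw_(u ⊗ y <- r) (b y x •: u)) ⊗ z).
  move: r; apply: tens_lin_ext => [||u y]; [lin|lin|]; symmetry.
  rewrite -[RHS](pairing_coevr_sw (f := fun z => u ⊗ z)); last by lin.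
  apply: eq_sweedler => x z; rewrite sweedler_pure; last by lin.
  by rewrite (linear_scale _ _ (pure_linl _)).
by rewrite (E t) (E t'); apply: eq_sweedler => x z; rewrite tt.
Qed.

Lemma pairing_ext_tensl (U : lmodType k) (t t' : Y ⊗ U) :
  (forall x, \sw_(y ⊗ u <- t) (b y x •: u) = \sw_(y ⊗ u <- t') (b y x •: u)) ->
  t = t'.
Proof.
move=> tt; have E (r : (Y ⊗ U)%type) :
    r = \sw_(x ⊗ z <- t0) (z ⊗ (\sw_(y ⊗ u <- r) (b y x •: u))).
  move: r; apply: tens_lin_ext => [||y u]; [lin|lin|]; symmetry.
  rewrite -[RHS](pairing_coevr_sw (f := fun z => z ⊗ u)); last by lin.
  apply: eq_sweedler => x z; rewrite sweedler_pure; last by lin.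
  by rewrite (linear_scale _ _ (pure_linr _)).
by rewrite (E t) (E t'); apply: eq_sweedler => x z; rewrite tt.
Qed.

Lemma pairing_ext_tensrr (U V : lmodType k) (t t' : U ⊗ (V ⊗ Y)) :
  (forall x, \sw_(u ⊗ r <- t) \sw_(v ⊗ y <- r) (b y x •: (u ⊗ v)) =
     \sw_(u ⊗ r <- t') \sw_(v ⊗ y <- r) (b y x •: (u ⊗ v))) ->
  t = t'.
Proof.
move=> tt; apply: (can_inj (@tens_assoc_invK k U V Y)).
apply: pairing_ext_tensr => x; rewrite /tens_assoc_inv.
have E (r : (U ⊗ (V ⊗ Y))%type) : \sw_(u ⊗ y <- (\sw_(u ⊗ s <- r) \sw_(v ⊗ w <- s) (u ⊗ v ⊗ w)))
    (b y x •: u) = \sw_(u ⊗ s <- r) \sw_(v ⊗ y <- s) (b y x •: (u ⊗ v)).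
  by sw_norm.
by rewrite !E.
Qed.

Lemma pairing_ext_tensrl (U V : lmodType k) (t t' : U ⊗ (Y ⊗ V)) :
  (forall x, \sw_(u ⊗ r <- t) \sw_(y ⊗ v <- r) (b y x •: (u ⊗ v)) =
     \sw_(u ⊗ r <- t') \sw_(y ⊗ v <- r) (b y x •: (u ⊗ v))) ->
  t = t'.
Proof.
move=> tt; have E (r : (U ⊗ (Y ⊗ V))%type) :
    r = \sw_(x ⊗ z <- t0)
      \sw_(u ⊗ v <- (\sw_(u ⊗ s <- r) \sw_(y ⊗ v <- s) (b y x •: (u ⊗ v)))) (u ⊗ (z ⊗ v)).
  move: r; apply: tens_lin_ext3r => [||u y v]; [lin|lin|]; symmetry.
  rewrite -[RHS](pairing_coevr_sw (f := fun z => u ⊗ (z ⊗ v))); last by lin.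
  apply: eq_sweedler => x z; sw_norm.
  have lF : linear (fun t : (U ⊗ V)%type => \sw_(u ⊗ v <- t) (u ⊗ (z ⊗ v))) by lin.
  by rewrite (linear_scale _ _ lF) sweedler_pure //; lin.
by rewrite (E t) (E t'); apply: eq_sweedler => x z; rewrite tt.
Qed.
End Theory.
End Pairing.

(** * The dual object *)

Section Dual.
Variables (k : fieldType) (H1 H2 : hopfAlgebra k) (s1 : hopfAntiAut H1) (s2 : hopfAntiAut H2).
Variables (M : lrModule H1 H2) (Y : lmodType k) (b : Y -> M -> k^o) (t0 : M ⊗ Y).
Hypothesis bP : pairing b t0.
Let bl := pairing_linl bP.
Let br := pairing_linr bP.
Let ksl := @kscale_linl k.
Let ksr := @kscale_linr k.
Local Notation g := (lr_deg M).
Local Notation α := ix_alpha.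
Local Notation β := ix_beta.
Local Notation γ := ix_gamma.
Local Notation δ := ix_delta.

(** [dual_autl * β g] and [dual_autl * α g] are the components α and β of [g^-1]; likewise
    [γ g * dual_autr] and [δ g * dual_autr] are its components δ and γ. The roles are exchanged
    because transposition reverses products. *)
Definition dual_autl : hopfAut H1 := ((α g)^-1 * (β g)^-1)%g.
Definition dual_autr : hopfAut H2 := ((δ g)^-1 * (γ g)^-1)%g.
Local Notation T1 a := (hanti_V s1 (dual_autl a)).
Local Notation T2 a := (hanti_V s2 (dual_autr a)).

(** Here and in the next three definitions [t0] converts a transposed structure map, which is a
    functional on [M], into an element built from [Y]. *)
Definition dual_lact (h : H1) (y : Y) : Y := \sw_(x ⊗ z <- t0) b y (lact (s1 h) x) •: z.
Definition dual_ract (y : Y) (h : H2) : Y := \sw_(x ⊗ z <- t0) b y (ract x (T2 h)) •: z.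
Definition dual_lcoact (y : Y) : H1 ⊗ Y :=
  \sw_(x ⊗ z <- t0) \sw_(a ⊗ x0 <- lcoact x) b y x0 •: (T1 a ⊗ z).
Definition dual_rcoact (y : Y) : Y ⊗ H2 :=
  \sw_(x ⊗ z <- t0) \sw_(x0 ⊗ a <- rcoact x) b y x0 •: (z ⊗ s2 a).

Lemma dual_lactE h y x : b (dual_lact h y) x = b y (lact (s1 h) x).
Proof.
rewrite (pairing_sweedlerl bP) -[RHS](pairing_coevl_sw bP (f := fun x => b y (lact (s1 h) x) : k^o));
  last by lin.
by apply: eq_sweedler => x' z; rewrite (pairingZl bP) mulrC.
Qed.

Lemma dual_ractE h y x : b (dual_ract y h) x = b y (ract x (T2 h)).
Proof.
rewrite (pairing_sweedlerl bP) -[RHS](pairing_coevl_sw bP (f := fun x => b y (ract x (T2 h)) : k^o));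
  last by lin.
by apply: eq_sweedler => x' z; rewrite (pairingZl bP) mulrC.
Qed.

(** This characterises the transposed coaction; the arbitrary [F] makes it usable under products and
    comultiplications. *)
Lemma dual_lcoact_sw (U : lmodType k) (F : H1 -> U) y x : linear F ->
  \sw_(a ⊗ y0 <- dual_lcoact y) b y0 x •: F a =
  \sw_(a ⊗ x0 <- lcoact x) b y x0 •: F (T1 a).
Proof.
move=> lF; rewrite /dual_lcoact.
rewrite -[RHS](pairing_coevl_sw bP (f := fun x => \sw_(a ⊗ x0 <- lcoact x) b y x0 •: F (T1 a)));
  last by lin.
sw_norm; apply: eq_sweedler => x' z; apply: eq_sweedler => a x0.
rewrite (linear_scale _ _ (sweedler_linear (f := fun a y0 => b y0 x •: F a) _)); last by lin.
rewrite sweedler_pure; last by lin.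
by rewrite /kscale !scalerA mulrC.
Qed.

Lemma dual_rcoact_sw (U : lmodType k) (F : H2 -> U) y x : linear F ->
  \sw_(y0 ⊗ a <- dual_rcoact y) b y0 x •: F a =
  \sw_(x0 ⊗ a <- rcoact x) b y x0 •: F (s2 a).
Proof.
move=> lF; rewrite /dual_rcoact.
rewrite -[RHS](pairing_coevl_sw bP (f := fun x => \sw_(x0 ⊗ a <- rcoact x) b y x0 •: F (s2 a)));
  last by lin.
sw_norm; apply: eq_sweedler => x' z; apply: eq_sweedler => x0 a.
rewrite (linear_scale _ _ (sweedler_linear (f := fun y0 a => b y0 x •: F a) _)); last by lin.
rewrite sweedler_pure; last by lin.
by rewrite /kscale !scalerA mulrC.
Qed.

Lemma hanti_dual_autl (f : hopfAut H1) h : T1 (f (s1 h)) = dual_autl (f h).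
Proof. by rewrite !hanti_haut hantiKV. Qed.

Lemma hanti_dual_autr (f : hopfAut H2) h : s2 (f (T2 h)) = f (dual_autr h).
Proof. by rewrite hanti_haut hantiVKV. Qed.

Lemma comul_dual_autl_sw (U : lmodType k) (F : H1 -> H1 -> U) h : bilin F ->
  \sw_(x ⊗ y <- comul (T1 h)) F x y = \sw_(x ⊗ y <- comul h) F (T1 y) (T1 x).
Proof. by move=> bF; have [Fl Fr] := bF; rewrite comul_hanti_sw // comul_haut_sw //; lin. Qed.

Lemma comul_dual_autr_sw (U : lmodType k) (F : H2 -> H2 -> U) h : bilin F ->
  \sw_(x ⊗ y <- comul (T2 h)) F x y = \sw_(x ⊗ y <- comul h) F (T2 y) (T2 x).
Proof. by move=> bF; have [Fl Fr] := bF; rewrite comul_hanti_sw // comul_haut_sw //; lin. Qed.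

(** Transposition reverses the order of two successive coactions and [T1] reverses the
    comultiplication, so the reversals cancel. *)
Lemma dual_lcoactA y :
  \sw_(x ⊗ y0 <- dual_lcoact y) \sw_(x1 ⊗ x2 <- comul x) (x1 ⊗ (x2 ⊗ y0)) =
  \sw_(x ⊗ y0 <- dual_lcoact y) \sw_(x' ⊗ y00 <- dual_lcoact y0) (x ⊗ (x' ⊗ y00)).
Proof.
apply: (pairing_ext_tensrr bP) => m.
transitivity (\sw_(x ⊗ m0 <- lcoact m) \sw_(x' ⊗ m00 <- lcoact m0) b y m00 •: (T1 x' ⊗ T1 x)).
  sw_norm.
  transitivity (\sw_(x ⊗ y0 <- dual_lcoact y) b y0 m •: \sw_(x1 ⊗ x2 <- comul x) (x1 ⊗ x2)).
    by apply: eq_sweedler => x y0; rewrite kscale_sweedler.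
  rewrite dual_lcoact_sw; last by lin.
  rewrite -lcoactA_sw; try lin.
  apply: eq_sweedler => x m0; rewrite comul_dual_autl_sw; last by lin.
  by rewrite kscale_sweedler.
sw_norm; symmetry.
transitivity (\sw_(x ⊗ m0 <- lcoact m) \sw_(x' ⊗ y0 <- dual_lcoact y) b y0 m0 •: (x' ⊗ T1 x)).
  rewrite [RHS]exchange_sweedler; apply: eq_sweedler => x y0.
  by rewrite (dual_lcoact_sw (F := fun x' => x ⊗ x')) //; lin.
apply: eq_sweedler => x m0.
by rewrite (dual_lcoact_sw (F := fun x' => x' ⊗ T1 x)) //; lin.
Qed.

Lemma dual_lcoact_counit y : \sw_(x ⊗ y0 <- dual_lcoact y) counit x *: y0 = y.
Proof.
apply: (pairing_ext bP) => m; rewrite (pairing_sweedlerl bP).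
transitivity (\sw_(x ⊗ y0 <- dual_lcoact y) b y0 m •: (counit x : k^o)).
  by apply: eq_sweedler => x y0; rewrite (pairingZl bP) mulrC.
rewrite (dual_lcoact_sw (F := fun x => counit x : k^o)); last by move=> a u v; rewrite linearP.
rewrite -[RHS](lcoact_counit_sw (f := fun m => b y m)); last by lin.
apply: eq_sweedler => x m0; rewrite hanti_counit haut_counit /kscale.
by rewrite /GRing.scale /= mulrC.
Qed.

Lemma dual_rcoactA y :
  \sw_(y0 ⊗ x <- dual_rcoact y) \sw_(y00 ⊗ x' <- dual_rcoact y0) (y00 ⊗ (x' ⊗ x)) =
  \sw_(y0 ⊗ x <- dual_rcoact y) \sw_(x1 ⊗ x2 <- comul x) (y0 ⊗ (x1 ⊗ x2)).
Proof.
apply: (pairing_ext_tensl bP) => m; symmetry.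
transitivity (\sw_(m0 ⊗ x <- rcoact m) \sw_(m00 ⊗ x' <- rcoact m0) b y m00 •: (s2 x ⊗ s2 x')).
  sw_norm.
  transitivity (\sw_(y0 ⊗ x <- dual_rcoact y) b y0 m •: \sw_(x1 ⊗ x2 <- comul x) (x1 ⊗ x2)).
    by apply: eq_sweedler => x y0; rewrite kscale_sweedler.
  rewrite dual_rcoact_sw; last by lin.
  rewrite rcoactA_sw; try lin.
  apply: eq_sweedler => x m0; rewrite comul_hanti_sw; last by lin.
  by rewrite kscale_sweedler.
sw_norm; symmetry.
transitivity (\sw_(m0 ⊗ x <- rcoact m) \sw_(y0 ⊗ x' <- dual_rcoact y) b y0 m0 •: (s2 x ⊗ x')).
  rewrite [RHS]exchange_sweedler; apply: eq_sweedler => x y0.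
  by rewrite (dual_rcoact_sw (F := fun x' => x' ⊗ y0)) //; lin.
apply: eq_sweedler => m0 x.
by rewrite (dual_rcoact_sw (F := fun x' => s2 x ⊗ x')) //; lin.
Qed.

Lemma dual_rcoact_counit y : \sw_(y0 ⊗ x <- dual_rcoact y) counit x *: y0 = y.
Proof.
apply: (pairing_ext bP) => m; rewrite (pairing_sweedlerl bP).
transitivity (\sw_(y0 ⊗ x <- dual_rcoact y) b y0 m •: (counit x : k^o)).
  by apply: eq_sweedler => x y0; rewrite (pairingZl bP) mulrC.
rewrite (dual_rcoact_sw (F := fun x => counit x : k^o)); last by move=> a u v; rewrite linearP.
rewrite -[RHS](rcoact_counit_sw (f := fun m => b y m)); last by lin.
apply: eq_sweedler => x m0; rewrite hanti_counit /kscale.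
by rewrite /GRing.scale /= mulrC.
Qed.

Lemma dual_bicomod y :
  \sw_(x ⊗ y0 <- dual_lcoact y) \sw_(y00 ⊗ u <- dual_rcoact y0) (x ⊗ (y00 ⊗ u)) =
  \sw_(y0 ⊗ u <- dual_rcoact y) \sw_(x ⊗ y00 <- dual_lcoact y0) (x ⊗ (y00 ⊗ u)).
Proof.
apply: (pairing_ext_tensrl bP) => m; sw_norm.
transitivity (\sw_(m0 ⊗ u <- rcoact m) \sw_(x ⊗ m00 <- lcoact m0) b y m00 •: (T1 x ⊗ s2 u)).
  transitivity (\sw_(m0 ⊗ u <- rcoact m) \sw_(x ⊗ y0 <- dual_lcoact y) b y0 m0 •: (x ⊗ s2 u)).
    rewrite [RHS]exchange_sweedler; apply: eq_sweedler => x y0.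
    by rewrite (dual_rcoact_sw (F := fun u => x ⊗ u)) //; lin.
  apply: eq_sweedler => m0 u.
  by rewrite (dual_lcoact_sw (F := fun x => x ⊗ s2 u)) //; lin.
rewrite -bicomod_sw; try lin; symmetry.
transitivity (\sw_(x ⊗ m0 <- lcoact m) \sw_(y0 ⊗ u <- dual_rcoact y) b y0 m0 •: (T1 x ⊗ u)).
  rewrite [RHS]exchange_sweedler; apply: eq_sweedler => y0 u.
  by rewrite (dual_lcoact_sw (F := fun x => x ⊗ u)) //; lin.
apply: eq_sweedler => x m0.
by rewrite (dual_rcoact_sw (F := fun u => T1 x ⊗ u)) //; lin.
Qed.

(** Paired with [m], this is the left law of [M] at [s1 h] with [T1] applied to the coefficients.
    Since [T1] reverses products, the two sides of that law are interchanged. *)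
Lemma dual_lact_lcoact h y :
  \sw_(h1 ⊗ h2 <- comul h) \sw_(x ⊗ y0 <- dual_lcoact y)
    ((α g^-1%g h1 * x) ⊗ dual_lact h2 y0) =
  \sw_(h1 ⊗ h2 <- comul h) \sw_(x ⊗ y0 <- dual_lcoact (dual_lact h1 y))
    ((x * β g^-1%g h2) ⊗ y0).
Proof.
apply: (pairing_ext_tensr bP) => m; sw_norm.
transitivity (\sw_(h1 ⊗ h2 <- comul (s1 h)) \sw_(x ⊗ m0 <- lcoact (lact h1 m))
    b y m0 •: T1 (x * β g h2)).
  rewrite comul_hanti_sw; last by lin.
  apply: eq_sweedler => h1 h2.
  transitivity (\sw_(x ⊗ y0 <- dual_lcoact y) b y0 (lact (s1 h2) m) •: (α g^-1%g h1 * x)).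
    by apply: eq_sweedler => x y0; rewrite dual_lactE.
  rewrite (dual_lcoact_sw (F := fun x => α g^-1%g h1 * x)); last by lin.
  apply: eq_sweedler => x m0; congr (_ •: _).
  rewrite hautM hantiM hanti_dual_autl.
  by rewrite /dual_autl; haut_eq.
rewrite -(lact_lcoact_sw (s1 h) m (f := fun x m0 => b y m0 •: T1 x)); last by lin.
rewrite comul_hanti_sw; last by lin.
apply: eq_sweedler => h1 h2.
rewrite (dual_lcoact_sw (F := fun x => x * β g^-1%g h2)); last by lin.
apply: eq_sweedler => x m0; rewrite dual_lactE; congr (_ •: _).
rewrite hautM hantiM hanti_dual_autl.
by rewrite /dual_autl; haut_eq.
Qed.

Lemma dual_lact_rcoact h y :
  dual_rcoact (dual_lact h y) = \sw_(y0 ⊗ u <- dual_rcoact y) (dual_lact h y0 ⊗ u).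
Proof.
apply: (pairing_ext_tensl bP) => m; sw_norm.
rewrite (dual_rcoact_sw (F := id)) //.
transitivity (\sw_(y0 ⊗ u <- dual_rcoact y) b y0 (lact (s1 h) m) •: u); last first.
  by apply: eq_sweedler => y0 u; rewrite dual_lactE.
rewrite (dual_rcoact_sw (F := id)) // lact_rcoact_sw; last by lin.
by apply: eq_sweedler => m0 u; rewrite dual_lactE.
Qed.

Lemma dual_ract_lcoact h y :
  dual_lcoact (dual_ract y h) = \sw_(x ⊗ y0 <- dual_lcoact y) (x ⊗ dual_ract y0 h).
Proof.
apply: (pairing_ext_tensr bP) => m; sw_norm.
rewrite (dual_lcoact_sw (F := id)) //.
transitivity (\sw_(x ⊗ y0 <- dual_lcoact y) b y0 (ract m (T2 h)) •: x); last first.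
  by apply: eq_sweedler => y0 u; rewrite dual_ractE.
rewrite (dual_lcoact_sw (F := id)) // ract_lcoact_sw; last by lin.
by apply: eq_sweedler => m0 u; rewrite dual_ractE.
Qed.

(** Likewise the right law of [M] at [T2 h], with [s2] applied to the coefficients. *)
Lemma dual_ract_rcoact h y :
  \sw_(h1 ⊗ h2 <- comul h) \sw_(y0 ⊗ u <- dual_rcoact y)
    (dual_ract y0 h1 ⊗ (u * δ g^-1%g h2)) =
  \sw_(h1 ⊗ h2 <- comul h) \sw_(y0 ⊗ u <- dual_rcoact (dual_ract y h2))
    (y0 ⊗ (γ g^-1%g h1 * u)).
Proof.
apply: (pairing_ext_tensl bP) => m; sw_norm.
transitivity (\sw_(h1 ⊗ h2 <- comul (T2 h)) \sw_(m0 ⊗ u <- rcoact (ract m h2))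
    b y m0 •: s2 (γ g h1 * u)).
  rewrite comul_dual_autr_sw; last by lin.
  apply: eq_sweedler => h1 h2.
  transitivity (\sw_(y0 ⊗ u <- dual_rcoact y) b y0 (ract m (T2 h1)) •: (u * δ g^-1%g h2)).
    by apply: eq_sweedler => x y0; rewrite dual_ractE.
  rewrite (dual_rcoact_sw (F := fun u => u * δ g^-1%g h2)); last by lin.
  apply: eq_sweedler => m0 u; congr (_ •: _).
  rewrite hantiM hanti_dual_autr.
  by rewrite /dual_autr; haut_eq.
rewrite -(ract_rcoact_sw (T2 h) m (f := fun m0 u => b y m0 •: s2 u)); last by lin.
rewrite comul_dual_autr_sw; last by lin.
apply: eq_sweedler => h1 h2.
rewrite (dual_rcoact_sw (F := fun u => γ g^-1%g h1 * u)); last by lin.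
apply: eq_sweedler => m0 u; rewrite dual_ractE; congr (_ •: _).
rewrite hantiM hanti_dual_autr.
by rewrite /dual_autr; haut_eq.
Qed.

Lemma dual_lr_axioms : lr_axioms g^-1%g dual_lact dual_ract dual_lcoact dual_rcoact.
Proof.
split.
- by split=> ?; rewrite /dual_lact; lin.
- by move=> y; apply: (pairing_ext bP) => m; rewrite dual_lactE hanti1 (lr_lact1 (lr_laws _)).
- move=> h h' y; apply: (pairing_ext bP) => m.
  by rewrite !dual_lactE hantiM (lr_lactM (lr_laws _)).
- by split=> ?; rewrite /dual_ract; lin.
- move=> y; apply: (pairing_ext bP) => m.
  by rewrite dual_ractE haut1 hanti1 (lr_ract1 (lr_laws _)).
- move=> h h' y; apply: (pairing_ext bP) => m.
  by rewrite !dual_ractE hautM hantiM (lr_ractM (lr_laws _)).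
- move=> h h' y; apply: (pairing_ext bP) => m.
  by rewrite dual_ractE !dual_lactE dual_ractE (lr_bimod (lr_laws _)).
- by rewrite /dual_lcoact; lin.
- exact: dual_lcoactA.
- exact: dual_lcoact_counit.
- by rewrite /dual_rcoact; lin.
- exact: dual_rcoactA.
- exact: dual_rcoact_counit.
- exact: dual_bicomod.
- exact: dual_lact_lcoact.
- exact: dual_lact_rcoact.
- exact: dual_ract_rcoact.
- exact: dual_ract_lcoact.
Qed.

Definition lr_dual : lrModule H1 H2 := LRModule dual_lr_axioms.

End Dual.

Lemma pure_kscale (k : fieldType) (U : lmodType k) (u : U) (c : k^o) : u ⊗ c = c •: (u ⊗ (1 : k^o)).
Proof. by rewrite /kscale -(linear_scale _ _ (pure_linr _)) [_ *: _]mulr1. Qed.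
Lemma pure_kscalel (k : fieldType) (U : lmodType k) (u : U) (c : k^o) : c ⊗ u = c •: ((1 : k^o) ⊗ u).
Proof. by rewrite /kscale -(linear_scale _ _ (pure_linl _)) [_ *: _]mulr1. Qed.

(** * Evaluation, coevaluation and rigidity *)

Section DualPair.
Variables (k : fieldType) (H1 H2 : hopfAlgebra k).
Local Notation α := ix_alpha.
Local Notation β := ix_beta.
Local Notation γ := ix_gamma.
Local Notation δ := ix_delta.
Implicit Types (X Y : lrModule H1 H2).
Let ksl := @kscale_linl k.
Let ksr := @kscale_linr k.

(* For [s1] and [s2] the antipodes, [Y] is a left dual of [X], with evaluation [b] and
   coevaluation [t0]. *)
Record dual_pair (s1 : hopfAntiAut H1) (s2 : hopfAntiAut H2) X Y
    (b : Y -> X -> k^o) (t0 : X ⊗ Y) : Prop := {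
  dual_pairing : pairing b t0;
  dual_deg : lr_deg Y = (lr_deg X)^-1%g;
  dual_pair_lact : forall h y x, b (lact h y) x = b y (lact (s1 h) x);
  dual_pair_ract : forall h y x,
    b (ract y h) x = b y (ract x (hanti_V s2 (dual_autr X h)));
  dual_pair_lcoact : forall y x,
    \sw_(a ⊗ y0 <- lcoact y) (b y0 x •: a) =
    \sw_(a ⊗ x0 <- lcoact x) (b y x0 •: hanti_V s1 (dual_autl X a));
  dual_pair_rcoact : forall y x,
    \sw_(y0 ⊗ a <- rcoact y) (b y0 x •: a) = \sw_(x0 ⊗ a <- rcoact x) (b y x0 •: s2 a)
}.

Lemma lr_dual_pair s1 s2 X (Y : lmodType k) (b : Y -> X -> k^o) t0 (bP : pairing b t0) :
  dual_pair (Y := lr_dual s1 s2 bP) s1 s2 b t0.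
Proof.
split=> //= [h y x|h y x|y x|y x]; first exact: dual_lactE.
- exact: dual_ractE.
- by rewrite (dual_lcoact_sw _ _ (F := id)).
- by rewrite (dual_rcoact_sw _ _ (F := id)).
Qed.

Section Theory.
Variables (s1 : hopfAntiAut H1) (s2 : hopfAntiAut H2).
Variables (X Y : lrModule H1 H2) (b : Y -> X -> k^o) (t0 : X ⊗ Y).
Hypothesis bP : dual_pair s1 s2 b t0.
Let pP := dual_pairing bP.
Let bl := pairing_linl pP.
Let br := pairing_linr pP.
Local Notation t1 := (hanti_V s1).
Local Notation t2 := (hanti_V s2).

Lemma dual_pair_lcoact_sw (U : lmodType k) (F : H1 -> U) y x : linear F ->
  \sw_(a ⊗ y0 <- lcoact y) b y0 x •: F a =
  \sw_(a ⊗ x0 <- lcoact x) b y x0 •: F (t1 (dual_autl X a)).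
Proof.
move=> lF; have := congr1 F (dual_pair_lcoact bP y x).
rewrite !(linear_sweedler _ _ lF) => E; etransitivity; [etransitivity; [|exact: E]|];
  by apply: eq_sweedler => ? ?; rewrite /kscale (linear_scale _ _ lF).
Qed.

Lemma dual_pair_rcoact_sw (U : lmodType k) (F : H2 -> U) y x : linear F ->
  \sw_(y0 ⊗ a <- rcoact y) b y0 x •: F a =
  \sw_(x0 ⊗ a <- rcoact x) b y x0 •: F (s2 a).
Proof.
move=> lF; have := congr1 F (dual_pair_rcoact bP y x).
rewrite !(linear_sweedler _ _ lF) => E; etransitivity; [etransitivity; [|exact: E]|];
  by apply: eq_sweedler => ? ?; rewrite /kscale (linear_scale _ _ lF).
Qed.

(** Moving a structure map back across the pairing inverts its anti-automorphism, and [dual_autl]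
    and [dual_autr] of [Y] are inverse to those of [X] because the indices are inverse. *)
Lemma dual_pair_flip :
  dual_pair (X := Y) (Y := X) t1 t2 (fun x y => b y x) (\sw_(x ⊗ y <- t0) (y ⊗ x)).
Proof.
have dg := dual_deg bP.
split=> [||h y x|h y x|y x|y x].
- split=> [y|x|y|x]; [exact: br|exact: bl| |]; sw_norm.
    exact: pairing_coevr.
  exact: pairing_coevl.
- by rewrite dg invgK.
- by rewrite (dual_pair_lact bP) hantiVKV.
- rewrite (dual_pair_ract bP) hanti_VV !hanti_haut hantiKV.
  by rewrite /dual_autr dg; haut_eq.
- rewrite (dual_pair_lcoact_sw (F := fun a => s1 (dual_autl Y a))); last by lin.
  apply: eq_sweedler => a x0; rewrite !hanti_haut hantiVKV.
  by rewrite /dual_autl dg; haut_eq.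
- rewrite (dual_pair_rcoact_sw (F := t2)); last by lin.
  by apply: eq_sweedler => a x0; rewrite hantiKV.
Qed.

Section LeftDual.
Hypotheses (s1E : s1 =1 antipode) (s2E : s2 =1 antipode).
Let dg := dual_deg bP.

Definition dual_ev (t : Y ⊗ X) : k^o := \sw_(y ⊗ x <- t) b y x.

(** The left action and right coaction contract by S(h_1) h_2, the right action by h_2 t(h_1), and
    the left coaction by t(h_2) h_1. For the last two, the twists on both factors reduce to one
    automorphism, the inverse of δ or β of [X], which can be pulled out of the product. *)
Lemma dual_ev_axioms : lr_hom_axioms (M := lr_tens Y X) (N := lr_unit H1 H2) dual_ev.
Proof.
rewrite /dual_ev; split; lr_unfold.
- by rewrite dg mulVg.
- by lin.
- move=> h; tens_ext y x; sw_norm.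
  rewrite -[in RHS](lr_lact1 (lr_laws _) x).
  rewrite -(antipodel_sw h (L := fun z => b y (lact z x))); last by lin.
  by apply: eq_sweedler => h1 h2; rewrite (dual_pair_lact bP) s1E -(lr_lactM (lr_laws _)).
- move=> h; tens_ext y x; sw_norm.
  (* The unit is written as the image of 1 under this common twist. *)
  rewrite -[in RHS](lr_ract1 (lr_laws _) x) -(haut1 (δ (lr_deg X))^-1%g).
  rewrite -(hanti_invr_sw s2E h (L := fun z => b y (ract x ((δ (lr_deg X))^-1%g z)))); last by lin.
  apply: eq_sweedler => h1 h2; rewrite (dual_pair_ract bP) -(lr_ractM (lr_laws _)).
  rewrite hautM -hanti_haut.
  by rewrite /dual_autr dg; haut_eq.
- tens_ext y x; sw_norm.
  transitivity (\sw_(c ⊗ x0 <- lcoact x) \sw_(c1 ⊗ c2 <- comul c)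
      b y x0 •: ((β (lr_deg X))^-1%g (t1 c2 * c1) ⊗ (1 : k^o))).
    rewrite pure_kscale -(lcoact_counit_sw (f := fun x0 => b y x0 •: (1 ⊗ (1 : k^o)))); last by lin.
    apply: eq_sweedler => c x0.
    rewrite (hanti_invl_sw s1E c (L := fun z => b y x0 •: ((β (lr_deg X))^-1%g z ⊗ (1 : k^o))));
      last by lin.
    by rewrite haut1.
  rewrite lcoactA_sw; try lin.
  rewrite [RHS]exchange_sweedler; apply: eq_sweedler => c x0.
  set f := (_ / _)%g.
  etransitivity; last first.
    by symmetry; apply: eq_sweedler => a y0; rewrite pure_kscale; reflexivity.
  rewrite (dual_pair_lcoact_sw (F := fun a => (α (lr_deg X) a * f c) ⊗ (1 : k^o))); last by lin.
  apply: eq_sweedler => a x00; rewrite hautM -!hanti_haut /f /dual_autl dg.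
  by haut_eq.
- tens_ext y x; sw_norm.
  transitivity (\sw_(x0 ⊗ c <- rcoact x) \sw_(c1 ⊗ c2 <- comul c)
      b y x0 •: ((1 : k^o) ⊗ (s2 c1 * c2))).
    rewrite pure_kscalel -(rcoact_counit_sw (f := fun x0 => b y x0 •: ((1 : k^o) ⊗ 1)));
      last by lin.
    apply: eq_sweedler => x0 c.
    rewrite -(antipodel_sw c (L := fun z => b y x0 •: ((1 : k^o) ⊗ z))); last by lin.
    by apply: eq_sweedler => c1 c2; rewrite s2E.
  rewrite -rcoactA_sw; try lin.
  rewrite [RHS]exchange_sweedler; apply: eq_sweedler => x0 c.
  etransitivity; last first.
    by symmetry; apply: eq_sweedler => y0 a; rewrite pure_kscalel; reflexivity.
  by rewrite (dual_pair_rcoact_sw (F := fun a => (1 : k^o) ⊗ (a * c))); last by lin.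
Qed.

(** The coevaluation is a morphism when [t0] is invariant and coinvariant. Contracting the factor
    [Y] with [m] moves everything onto [X], where h_1 S(h_2) = ε(h) applies here and to the right
    coaction; the other two cases use t(h_2) h_1 and h_2 t(h_1). *)
Lemma dual_coev_lact h : tens_lact h t0 = counit h *: t0.
Proof.
apply: (pairing_ext_tensr pP) => m; rewrite /tens_lact; sw_norm.
rewrite (linear_scale _ _ (sweedler_linear (f := fun x y => b y m •: x) _)); last by lin.
rewrite (pairing_coevl_sw pP (f := id)) // -[in RHS](lr_lact1 (lr_laws _) m).
rewrite -(antipoder_sw h (L := fun z => lact z m)); last by lin.
apply: eq_sweedler => h1 h2; rewrite -s1E (lr_lactM (lr_laws _)).
rewrite -[RHS](pairing_coevl_sw pP (f := fun x => lact h1 x)); last by lin.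
by apply: eq_sweedler => x y; rewrite (dual_pair_lact bP).
Qed.

Lemma dual_coev_ract h : tens_ract t0 h = counit h *: t0.
Proof.
apply: (pairing_ext_tensr pP) => m; rewrite /tens_ract; sw_norm.
rewrite (linear_scale _ _ (sweedler_linear (f := fun x y => b y m •: x) _)); last by lin.
rewrite (pairing_coevl_sw pP (f := id)) // -[in RHS](lr_ract1 (lr_laws _) m).
rewrite -(haut1 (γ (lr_deg Y))).
rewrite -(hanti_invl_sw s2E h (L := fun z => ract m (γ (lr_deg Y) z))); last by lin.
apply: eq_sweedler => h1 h2; rewrite hautM (lr_ractM (lr_laws _)).
rewrite -[RHS](pairing_coevl_sw pP (f := fun x => ract x (γ (lr_deg Y) h1))); last by lin.
apply: eq_sweedler => x y; rewrite (dual_pair_ract bP) -hanti_haut /dual_autr dg.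
by haut_eq.
Qed.

Lemma dual_coev_lcoact : tens_lcoact t0 = 1 ⊗ t0.
Proof.
apply: (pairing_ext_tensrr pP) => m; rewrite /tens_lcoact; sw_norm.
set f := (_ / _)%g.
rewrite (pairing_coevl_sw pP (f := fun x => 1 ⊗ x)); last by lin.
transitivity (\sw_(c ⊗ m0 <- lcoact m) \sw_(c1 ⊗ c2 <- comul c)
    (α (lr_deg Y) (c2 * t1 c1) ⊗ m0)).
  rewrite lcoactA_sw; try lin.
  transitivity (\sw_(c ⊗ m0 <- lcoact m) \sw_(x ⊗ y <- t0)
      b y m0 •: \sw_(a ⊗ x0 <- lcoact x) (α (lr_deg Y) a * f (t1 (dual_autl X c)) ⊗ x0)).
    rewrite [RHS]exchange_sweedler; apply: eq_sweedler => x y.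
    transitivity (\sw_(c ⊗ y0 <- lcoact y) b y0 m •:
        \sw_(a ⊗ x0 <- lcoact x) (α (lr_deg Y) a * f c ⊗ x0)).
      rewrite [LHS]exchange_sweedler.
      by apply: eq_sweedler => c y0; rewrite kscale_sweedler.
    by rewrite (dual_pair_lcoact_sw (F := fun c =>
      \sw_(a ⊗ x0 <- lcoact x) (α (lr_deg Y) a * f c ⊗ x0))); last by lin.
  apply: eq_sweedler => c m0.
  rewrite (pairing_coevl_sw pP (f := fun x =>
    \sw_(a ⊗ x0 <- lcoact x) (α (lr_deg Y) a * f (t1 (dual_autl X c)) ⊗ x0))); last by lin.
  apply: eq_sweedler => a x0; rewrite hautM -!hanti_haut /f /dual_autl dg.
  by haut_eq.
rewrite -[RHS](lcoact_counit_sw (f := fun m0 => 1 ⊗ m0)); last by lin.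
apply: eq_sweedler => c m0.
rewrite (hanti_invr_sw s1E c (L := fun z => α (lr_deg Y) z ⊗ m0)); last by lin.
by rewrite haut1.
Qed.

Lemma dual_coev_rcoact : tens_rcoact t0 = t0 ⊗ 1.
Proof.
(* Rebracketing puts [Y] in the position expected by [pairing_ext_tensrl]. *)
apply: (can_inj (@tens_assocK k X Y H2)).
apply: (pairing_ext_tensrl pP) => m; rewrite /tens_rcoact /tens_assoc; sw_norm.
rewrite (pairing_coevl_sw pP (f := fun x => x ⊗ 1)); last by lin.
transitivity (\sw_(m0 ⊗ c <- rcoact m) \sw_(c1 ⊗ c2 <- comul c) (m0 ⊗ (c1 * antipode c2))).
  rewrite -rcoactA_sw; try lin.
  transitivity (\sw_(m0 ⊗ c <- rcoact m) \sw_(x ⊗ y <- t0)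
      b y m0 •: \sw_(x0 ⊗ a <- rcoact x) (x0 ⊗ (a * s2 c))).
    rewrite [RHS]exchange_sweedler; apply: eq_sweedler => x y.
    transitivity (\sw_(y0 ⊗ c <- rcoact y) b y0 m •:
        \sw_(x0 ⊗ a <- rcoact x) (x0 ⊗ (a * c))).
      rewrite [LHS]exchange_sweedler.
      by apply: eq_sweedler => c y0; rewrite kscale_sweedler.
    by rewrite (dual_pair_rcoact_sw (F := fun c =>
      \sw_(x0 ⊗ a <- rcoact x) (x0 ⊗ (a * c)))); last by lin.
  apply: eq_sweedler => m0 c.
  rewrite (pairing_coevl_sw pP (f := fun x =>
    \sw_(x0 ⊗ a <- rcoact x) (x0 ⊗ (a * s2 c)))); last by lin.
  by apply: eq_sweedler => a x0; rewrite s2E.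
rewrite -[RHS](rcoact_counit_sw (f := fun m0 => m0 ⊗ 1)); last by lin.
apply: eq_sweedler => m0 c.
by rewrite (antipoder_sw c (L := fun z => m0 ⊗ z)); last by lin.
Qed.

Definition dual_coev (c : k^o) : X ⊗ Y := c •: t0.

Lemma dual_coev_axioms : lr_hom_axioms (M := lr_unit H1 H2) (N := lr_tens X Y) dual_coev.
Proof.
rewrite /dual_coev; split.
- by rewrite /= dg mulgV.
- by lin.
- move=> h c /=; have [_ L] := tens_lact_bilin X Y.
  by rewrite /kscale (linear_scale _ _ (L h)) dual_coev_lact /unit_lact !scalerA mulrC.
- move=> h c /=; have [L _] := tens_ract_bilin X Y.
  by rewrite /kscale (linear_scale _ _ (L h)) dual_coev_ract /unit_ract !scalerA mulrC.
- move=> c /=; rewrite /unit_lcoact sweedler_pure; last by lin.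
  rewrite /kscale (linear_scale _ _ (@tens_lcoact_lin _ _ _ X Y)) dual_coev_lcoact.
  by rewrite (linear_scale _ _ (pure_linr _)).
- move=> c /=; rewrite /unit_rcoact sweedler_pure; last by lin.
  rewrite /kscale (linear_scale _ _ (@tens_rcoact_lin _ _ _ X Y)) dual_coev_rcoact.
  by rewrite (linear_scale _ _ (pure_linl _)).
Qed.
End LeftDual.
End Theory.

(** On underlying spaces the duality identities are [pairing_coevl] and [pairing_coevr]. *)
Lemma lrfd_left_dual (s1 : hopfAntiAut H1) (s2 : hopfAntiAut H2) (X Y : lrfdModule H1 H2)
    (b : Y -> X -> k^o) (t0 : X ⊗ Y) :
    s1 =1 antipode -> s2 =1 antipode -> dual_pair (X := X) (Y := Y) s1 s2 b t0 ->
  exists ev coev, is_left_dual (C := LRfd H1 H2) (X := X) (Xd := Y) ev coev.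
Proof.
move=> s1E s2E bP; have pP := dual_pairing bP.
have bl := pairing_linl pP; have br := pairing_linr pP.
exists (LRHom (dual_ev_axioms bP s1E s2E)), (LRHom (dual_coev_axioms bP s1E s2E)).
split; apply: lr_homP => x /=;
  rewrite /tens_map /tens_assoc /tens_assoc_inv /tens_lunit_inv /tens_runit_inv
    /tens_lunit /tens_runit /dual_coev /dual_ev; sw_norm.
  rewrite [1 •: t0]scale1r; exact: pairing_coevl.
rewrite [1 •: t0]scale1r; exact: pairing_coevr.
Qed.

Lemma lrfd_rigid : bijective (@antipode k H1) -> bijective (@antipode k H2) ->
  is_rigid (LRfd H1 H2).
Proof.
move=> /antipode_hanti[s1 s1E] /antipode_hanti[s2 s2E] X.
have [b [t0 bP]] := fin_dim_pairing (lrfd_fin_dim X); split.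
  pose Y := @LRfdModule _ H1 H2 (lr_dual s1 s2 bP) (lrfd_fin_dim X).
  by exists Y; apply: (@lrfd_left_dual s1 s2 X Y _ _ s1E s2E (lr_dual_pair s1 s2 bP)).
pose Y := @LRfdModule _ H1 H2 (lr_dual (hanti_V s1) (hanti_V s2) bP) (lrfd_fin_dim X).
have YP := dual_pair_flip (lr_dual_pair (hanti_V s1) (hanti_V s2) bP).
(* [hanti_V (hanti_V s1)] has the same underlying map as [s1], and similarly for [s2], so [s1E] and
   [s2E] apply by conversion. *)
have [ev [coev [zz1 zz2]]] :=
  @lrfd_left_dual (hanti_V (hanti_V s1)) (hanti_V (hanti_V s2)) Y X _ _ s1E s2E YP.
(* The identities making [X] a left dual of [Y] are those making [Y] a right dual of [X], in the
   opposite order. *)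
by exists Y, ev, coev.
Qed.

End DualPair.

Theorem theorem2p12 (k : fieldType) (H1 H2 : hopfAlgebra k) :
  bijective (@antipode k H1) -> bijective (@antipode k H2) ->
  exists c : forall M N : LRfd H1 H2,
      tc_hom (tc_tens M N) (tc_tens (tc_conj (tc_deg M) N) M),
    (forall (M N : lrfdModule H1 H2) (m : M) (n : N),
      c M N (m ⊗ n) =
      \sw_(x ⊗ m0 <- lcoact m) \sw_(n0 ⊗ y <- rcoact n)
        (lact ((ix_beta (lr_deg M))^-1%g x) n0 ⊗
         ract m0 ((ix_delta (lr_deg M))^-1%g y))) /\
    is_rigid_braided_tcategory c.
Proof.
move=> b1 b2; exists (fun M N : LRfd H1 H2 => lr_braid M N); split.
  by move=> M N m n; rewrite /= /braid sweedler_pure; last by lin.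
split; [exact: lrfd_crossed|exact: lrfd_braiding|exact: lrfd_rigid].
Qed.
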